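(* There is an algorithm which, given a set $S$ of $n$ trajectories and an integer $k$ with $1\leq k\leq n$, finds a $k$-clustering $\mathcal{C}$ of $S$ minimizing $\operatorname{sd}(\mathcal{C})$ among all $k$-clusterings of $S$, in time $O\!\left((k-1)!\,n^{2k-1}\log n\right)$. In particular, for each fixed $k$ the sum of diameters kinetic 1D $k$-clustering problem is solvable in polynomial time.
   Context: A trajectory $i$ is given by a pair of real numbers $(x_i(0),v_i)$ and is identified with the affine function $x_i(t)=x_i(0)+v_i t$, $t\in[0,1]$. Distinct elements of a set of trajectories are distinct functions. A cluster of a finite set $S$ of trajectories is a (possibly empty) subset of $S$. A $k$-clustering of $S$ is a partition of $S$ into $k$ pairwise disjoint clusters with union $S$, where empty clusters are allowed. The diameter of a nonempty cluster $C$ is $\operatorname{diam}(C)=\int_0^1\left(\max_{i\in C}x_i(t)-\min_{i\in C}x_i(t)\right)\mathrm{d}t$, and $\operatorname{diam}(\emptyset)=0$. For a $k$-clustering $\mathcal{C}$, $\operatorname{sd}(\mathcal{C})=\sum_{C\in\mathcal{C}}\operatorname{diam}(C)$. The sum of diameters kinetic 1D $k$-clustering problem asks, given $S$ and $k$, for a $k$-clustering minimizing $\operatorname{sd}$. Running time counts elementary operations, with each arithmetic operation and comparison on real numbers having unit cost. *)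

(* Defs.v *)
From HB Require Import structures.
From mathcomp Require Import all_boot all_order all_algebra.
From mathcomp Require Import all_classical all_reals all_analysis.

Set Implicit Arguments.
Unset Strict Implicit.
Unset Printing Implicit Defensive.

Import Order.TTheory GRing.Theory Num.Theory.

Local Open Scope ring_scope.

(** * Kinetic clustering

    A set of [n] trajectories is a family [S : 'I_n -> trajectory R] that is
    injective: an affine function on [0,1] determines its pair (x(0), v), so
    distinct pairs are the same thing as distinct functions.  Clusters are sets
    of indices. *)

Definition trajectory (R : realType) : Type := (R * R)%type.

Definition position (R : realType) (x : trajectory R) (t : R) : R :=
  x.1 + x.2 * t.

Section Clustering.
Variables (R : realType) (n : nat) (S : 'I_n -> trajectory R).

(* [R] has no least or greatest element to start the iterated maximum and
   minimum from; they start from a member of [C], hence are the maximum and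
   minimum over [C]. *)
Definition diam (C : {set 'I_n}) : R :=
  if [pick i in C] is Some i0 then
    \int[lebesgue_measure]_(t in `[0, 1]%classic)
      (\big[Num.max/position (S i0) t]_(i in C) position (S i) t
       - \big[Num.min/position (S i0) t]_(i in C) position (S i) t)
  else 0.

Definition is_clustering (k : nat) (C : 'I_k -> {set 'I_n}) : Prop :=
  (\bigcup_(j < k) C j)%SET = [set: 'I_n]%SET
  /\ forall i j : 'I_k, i != j -> [disjoint C i & C j].

Definition sd (k : nat) (C : 'I_k -> {set 'I_n}) : R := \sum_(j < k) diam (C j).

Definition optimal_clustering (k : nat) (C : 'I_k -> {set 'I_n}) : Prop :=
  is_clustering C
  /\ forall C' : 'I_k -> {set 'I_n}, is_clustering C' -> sd C <= sd C'.

End Clustering.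

(** * The real RAM

    While programs over finitely many named arrays of natural numbers and of
    real numbers; a scalar variable is cell 0 of an array.  Every operator,
    constant, memory access, assignment and branch costs one unit.

    The instruction set is kept weak so that unit cost is meaningful: integers,
    which serve as indices and counters, have no multiplication, real numbers
    cannot be rounded or converted to integers, and the only real constants are
    natural numbers.  A program is finite and does not depend on the size of
    its input. *)

Inductive iexp : Type :=
| IConst of nat
| IGet of nat & iexp          (* array name, index *)
| IAdd of iexp & iexp
| ISub of iexp & iexp.        (* truncated *)

Inductive rexp : Type :=
| RConst of nat
| RGet of nat & iexp
| RAdd of rexp & rexp
| RSub of rexp & rexp
| RMul of rexp & rexp
| RDiv of rexp & rexp.        (* x / 0 = 0 *)

Inductive bexp : Type :=
| BILe of iexp & iexp
| BRLe of rexp & rexp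
| BNot of bexp
| BAnd of bexp & bexp.        (* evaluates both arguments *)

Inductive cmd : Type :=
| Skip
| ISet of nat & iexp & iexp   (* array name, index, value *)
| RSet of nat & iexp & rexp
| Seq of cmd & cmd
| If of bexp & cmd & cmd
| While of bexp & cmd.

Fixpoint icost (e : iexp) : nat :=
  match e with
  | IConst _ => 1
  | IGet _ e1 => (icost e1).+1
  | IAdd e1 e2 | ISub e1 e2 => (icost e1 + icost e2).+1
  end.

Fixpoint rcost (e : rexp) : nat :=
  match e with
  | RConst _ => 1
  | RGet _ e1 => (icost e1).+1
  | RAdd e1 e2 | RSub e1 e2 | RMul e1 e2 | RDiv e1 e2 =>
      (rcost e1 + rcost e2).+1
  end.

Fixpoint bcost (b : bexp) : nat :=
  match b with
  | BILe e1 e2 => (icost e1 + icost e2).+1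
  | BRLe e1 e2 => (rcost e1 + rcost e2).+1
  | BNot b1 => (bcost b1).+1
  | BAnd b1 b2 => (bcost b1 + bcost b2).+1
  end.

Section Semantics.
Variable R : realType.

Record store : Type := Store {
  imem : nat -> nat -> nat;
  rmem : nat -> nat -> R
}.

Definition update (T : Type) (m : nat -> nat -> T) (a i : nat) (v : T) :
    nat -> nat -> T :=
  fun b j => if (b == a) && (j == i) then v else m b j.

Fixpoint ieval (s : store) (e : iexp) : nat :=
  match e with
  | IConst m => m
  | IGet a e1 => imem s a (ieval s e1)
  | IAdd e1 e2 => (ieval s e1 + ieval s e2)%N
  | ISub e1 e2 => (ieval s e1 - ieval s e2)%N
  end.

Fixpoint reval (s : store) (e : rexp) : R :=
  match e with
  | RConst m => m%:R
  | RGet a e1 => rmem s a (ieval s e1)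
  | RAdd e1 e2 => reval s e1 + reval s e2
  | RSub e1 e2 => reval s e1 - reval s e2
  | RMul e1 e2 => reval s e1 * reval s e2
  | RDiv e1 e2 => reval s e1 / reval s e2
  end.

Fixpoint beval (s : store) (b : bexp) : bool :=
  match b with
  | BILe e1 e2 => (ieval s e1 <= ieval s e2)%N
  | BRLe e1 e2 => reval s e1 <= reval s e2
  | BNot b1 => ~~ beval s b1
  | BAnd b1 b2 => beval s b1 && beval s b2
  end.

(* [exec c s t s']: from store [s], command [c] halts in store [s'] after
   exactly [t] elementary operations. *)
Inductive exec : cmd -> store -> nat -> store -> Prop :=
| exec_skip s : exec Skip s 1 s
| exec_iset s a e v :
    exec (ISet a e v) s (icost e + icost v).+1
      (Store (update (imem s) a (ieval s e) (ieval s v)) (rmem s))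
| exec_rset s a e v :
    exec (RSet a e v) s (icost e + rcost v).+1
      (Store (imem s) (update (rmem s) a (ieval s e) (reval s v)))
| exec_seq c1 c2 s1 s2 s3 t1 t2 :
    exec c1 s1 t1 s2 -> exec c2 s2 t2 s3 ->
    exec (Seq c1 c2) s1 (t1 + t2) s3
| exec_if b c1 c2 s t s' :
    exec (if beval s b then c1 else c2) s t s' ->
    exec (If b c1 c2) s (bcost b + t).+1 s'
| exec_while_false b c s :
    ~~ beval s b -> exec (While b c) s (bcost b).+1 s
| exec_while_true b c s1 s2 s3 t1 t2 :
    beval s1 b -> exec c s1 t1 s2 -> exec (While b c) s2 t2 s3 ->
    exec (While b c) s1 (bcost b + t1 + t2).+1 s3.

End Semantics.

(** * Algorithms for the clustering problem

    Input: integer array 0 holds [n] and [k] in cells 0 and 1; cell [i < n] of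
    real arrays 0 and 1 holds the initial position and the velocity of the
    [i]-th trajectory; all other cells hold 0.
    Output: cell [i < n] of integer array 1 holds the number, below [k], of the
    cluster that contains the [i]-th trajectory. *)

Definition input_store (R : realType) (n : nat) (S : 'I_n -> trajectory R)
    (k : nat) : store R :=
  Store
    (fun a i => if a == 0%N then
                  (if i == 0%N then n else if i == 1%N then k else 0%N)
                else 0%N)
    (fun a i => if insub i is Some j then
                  (if a == 0%N then (S j).1
                   else if a == 1%N then (S j).2 else 0)
                else 0).

Definition output_clustering (R : realType) (n k : nat) (s : store R) :
    'I_k -> {set 'I_n} :=
  fun j => finset (fun i : 'I_n => imem s 1 i == j).
Arguments output_clustering {R} n k s _.

(* On input [S], [k] the program [P] halts after exactly [t] elementary
   operations, having found an optimal [k]-clustering of [S]; [exec] is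
   deterministic, so [t] is the running time. *)
Definition finds_optimum (R : realType) (P : cmd) (n : nat)
    (S : 'I_n -> trajectory R) (k t : nat) : Prop :=
  exists2 s : store R,
    exec P (input_store S k) t s
    & optimal_clustering S (output_clustering n k s).

(* Main.v *)
(* If, at every time in [0,1], the intervals spanned by a family of clusters
   have a connected union, then merging the family does not increase the sum of
   diameters: the length of a connected union is at most the sum of the lengths.
   Otherwise, at some time, a point between two intervals splits the family.
   Hence some optimal clustering arises from the trivial one by k - 1 steps, the
   j-th of which cuts one of j parts in two, by a point in space-time.  Moving
   that point back in time to the last crossing that it separates shows that
   n (n + 1) / 2 cuts suffice, each encoded by a pair of trajectories.

   The program runs through all (k - 1)! (n (n + 1) / 2)^(k - 1) sequences of
   steps with an odometer.  It evaluates one in time O(k n): the trajectories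
   are sorted by velocity once and for all, so the envelopes of a cluster are
   obtained by a linear stack algorithm, and a diameter is the sum of the
   integrals of two upper envelopes.  Since n (n + 1) / 2 <= 3/4 n^2, the
   factor k is absorbed by (3/4)^(k - 1). *)

(* The correctness argument is one-sided. Whatever cuts are tried, k - 1 of them give labels below
   k, so every evaluated sequence is a k-clustering; it remains to show that for each clustering
   some tabulated sequence does at least as well. The obstacle is that the number of cuts is fixed,
   whereas a part without a gap cannot be cut along its clusters. Such a part is merged, and the
   step is spent on an idle cut with every trajectory above it: the merged part takes the new label
   and empty clusters keep the old one. The induction over the cuts therefore carries a clustering
   that may change but never gets worse, and a map from its clusters onto the parts made so far. The
   case k = 1 stands apart, because the bound is then linear in n and leaves no time for the
   quadratic sorting and tabulation. *)
Require Import Defs.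
From HB Require Import structures.
From mathcomp Require Import all_boot all_order all_algebra.
From mathcomp Require Import all_classical all_reals all_analysis.
From mathcomp Require Import zify ring lra.

Set Implicit Arguments.
Unset Strict Implicit.
Unset Printing Implicit Defensive.

Import Order.TTheory GRing.Theory Num.Theory.

Local Open Scope ring_scope.

(** * Total correctness with time bounds *)

Fixpoint imod (c : cmd) : seq nat :=
  match c with
  | ISet a _ _ => [:: a]
  | Seq c1 c2 | If _ c1 c2 => imod c1 ++ imod c2
  | While _ c1 => imod c1
  | _ => [::]
  end.

Fixpoint rmod (c : cmd) : seq nat :=
  match c with
  | RSet a _ _ => [:: a]
  | Seq c1 c2 | If _ c1 c2 => rmod c1 ++ rmod c2
  | While _ c1 => rmod c1
  | _ => [::]
  end.

Fixpoint loop_free (c : cmd) : bool :=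
  match c with
  | Seq c1 c2 | If _ c1 c2 => loop_free c1 && loop_free c2
  | While _ _ => false
  | _ => true
  end.

(* The value 0 at [While] is junk, as is the value of [run] below. *)
Fixpoint max_cost (c : cmd) : nat :=
  match c with
  | Skip => 1
  | ISet _ e v => (icost e + icost v).+1
  | RSet _ e v => (icost e + rcost v).+1
  | Seq c1 c2 => (max_cost c1 + max_cost c2)%N
  | If b c1 c2 => (bcost b + maxn (max_cost c1) (max_cost c2)).+1
  | While _ _ => 0
  end.

Section Logic.
Variable R : realType.
Implicit Types (s : store R) (c : cmd) (Q : store R -> Prop).

Fixpoint run c s : store R :=
  match c with
  | Skip | While _ _ => s
  | ISet a e v => Store (update (imem s) a (ieval s e) (ieval s v)) (rmem s)
  | RSet a e v => Store (imem s) (update (rmem s) a (ieval s e) (reval s v))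
  | Seq c1 c2 => run c2 (run c1 s)
  | If b c1 c2 => if beval s b then run c1 s else run c2 s
  end.

Definition halts c T s Q : Prop :=
  exists s' t, [/\ exec c s t s', (t <= T)%N & Q s'].

(** Reduces reasoning about loop-free code to computation of [run] and [max_cost]. *)
Lemma halts_run c s Q : loop_free c -> Q (run c s) -> halts c (max_cost c) s Q.
Proof.
move=> lfc Qs; exists (run c s).
suff [t ct tT] : exists2 t, exec c s t (run c s) & (t <= max_cost c)%N.
  by exists t.
elim: c s lfc {Qs} => [|a e v|a e v|c1 IH1 c2 IH2|b c1 IH1 c2 IH2|//] s /=.
- by exists 1%N => //; constructor.
- by eexists; first by constructor.
- by eexists; first by constructor.
- case/andP=> /(IH1 s)[t1 e1 l1] /(IH2 (run c1 s))[t2 e2 l2].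
  by exists (t1 + t2)%N; [econstructor; eauto | exact: leq_add].
- case/andP=> /(IH1 s)[t1 e1 l1] /(IH2 s)[t2 e2 l2].
  case bs : (beval s b).
  + exists (bcost b + t1).+1; first by constructor; rewrite bs.
    by rewrite ltnS leq_add2l leq_max l1.
  + exists (bcost b + t2).+1; first by constructor; rewrite bs.
    by rewrite ltnS leq_add2l leq_max l2 orbT.
Qed.

Lemma halts_weaken c s T1 T2 Q1 Q2 :
  halts c T1 s Q1 -> (T1 <= T2)%N -> (forall s', Q1 s' -> Q2 s') ->
  halts c T2 s Q2.
Proof.
move=> [s' [t [e l q]]] T12 Q12; exists s', t; split => //; last exact: Q12.
exact: leq_trans T12.
Qed.

Lemma halts_run_le c T s Q :
  loop_free c -> (max_cost c <= T)%N -> Q (run c s) -> halts c T s Q.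
Proof. by move=> lfc cT Qs; apply: halts_weaken (halts_run lfc Qs) cT _. Qed.

Lemma halts_seq c1 c2 T1 T2 s Q1 Q2 :
  halts c1 T1 s Q1 -> (forall s', Q1 s' -> halts c2 T2 s' Q2) ->
  halts (Seq c1 c2) (T1 + T2) s Q2.
Proof.
move=> [s1 [t1 [e1 l1 q1]]] /(_ _ q1)[s2 [t2 [e2 l2 q2]]].
exists s2, (t1 + t2)%N; split => //; last exact: leq_add.
by econstructor; eauto.
Qed.

Lemma halts_seq_run c1 c2 T s Q : loop_free c1 ->
  halts c2 T (run c1 s) Q -> halts (Seq c1 c2) (max_cost c1 + T) s Q.
Proof.
move=> lf1 h2; apply: (@halts_seq _ _ _ _ _ (fun s1 => s1 = run c1 s)).
  exact: halts_run.
by move=> s1 ->.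
Qed.

Lemma halts_if b c1 c2 T s Q :
  halts (if beval s b then c1 else c2) T s Q ->
  halts (If b c1 c2) (bcost b + T).+1 s Q.
Proof.
move=> [s' [t [e l q]]]; exists s', (bcost b + t).+1; split => //.
  by constructor.
by rewrite ltnS leq_add2l.
Qed.

(** A frame condition for whole arrays, read off the syntax; it spares the invariants from listing
    what a command does not write. *)
Definition unchanged c s s' : Prop :=
  (forall a, a \notin imod c -> imem s' a = imem s a) /\
  (forall a, a \notin rmod c -> rmem s' a = rmem s a).

Lemma exec_unchanged c s t s' : exec c s t s' -> unchanged c s s'.
Proof.
rewrite /unchanged; elim => {c s t s'} //=.
- move=> s a e v; split => // b; rewrite inE => /negbTE ba.
  by rewrite /update ba.
- move=> s a e v; split => // b; rewrite inE => /negbTE ba.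
  by rewrite /update ba.
- move=> c1 c2 s1 s2 s3 t1 t2 _ [I1 R1] _ [I2 R2].
  by split=> a; rewrite mem_cat negb_or => /andP[a1 a2]; [rewrite I2 ?I1|rewrite R2 ?R1].
- move=> b c1 c2 s t s' _ []; case: ifP => _ I1 R1; split=> a;
  by rewrite mem_cat negb_or => /andP[a1 a2]; rewrite ?I1 ?R1.
- move=> b c s1 s2 s3 t1 t2 _ _ [I1 R1] _ [I2 R2].
  by split=> a am; [rewrite I2 ?I1|rewrite R2 ?R1].
Qed.

Lemma unchanged_trans c s1 s2 s3 :
  unchanged c s1 s2 -> unchanged c s2 s3 -> unchanged c s1 s3.
Proof.
by move=> [I1 R1] [I2 R2]; split=> a am; [rewrite I2 ?I1|rewrite R2 ?R1].
Qed.

Lemma halts_while_aux b c (I : store R -> Prop) (mu : store R -> nat) T m s :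
  (forall s, I s -> beval s b ->
     halts c T s (fun s' => I s' /\ (mu s' < mu s)%N)) ->
  I s -> (mu s <= m)%N ->
  halts (While b c) (m * (T + (bcost b).+1) + (bcost b).+1) s
    (fun s' => I s' /\ ~~ beval s' b).
Proof.
move=> body; elim: m s => [|m IH] s Is mus; case bs : (beval s b).
- by have [s' [t [_ _ [_]]]] := body s Is bs; rewrite ltnNge (leq_trans mus).
- exists s, (bcost b).+1; split => //; last by rewrite bs.
  by constructor; rewrite bs.
- have [s1 [t1 [e1 l1 [I1 lt1]]]] := body s Is bs.
  have [|s2 [t2 [e2 l2 q2]]] := IH s1 I1.
    by rewrite -ltnS (leq_trans lt1).
  exists s2, (bcost b + t1 + t2).+1; split => //; last by lia.
  exact: exec_while_true e1 e2.
- exists s, (bcost b).+1; split => //; last by rewrite bs.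
    by constructor; rewrite bs.
  exact: leq_addl.
Qed.

Lemma halts_frame c T s Q :
  halts c T s Q -> halts c T s (fun s' => Q s' /\ unchanged c s s').
Proof.
move=> [s' [t [e l q]]]; exists s', t; split => //; split => //.
exact: exec_unchanged e.
Qed.

(** The body may assume that the store agrees with [s0] outside the arrays it writes, so [I] need
    only speak of the latter. The time is that of [m] rounds and one failing test. *)
Lemma halts_while b c (I : store R -> Prop) (mu : store R -> nat) T m s0 :
  (forall s, unchanged c s0 s -> I s -> beval s b ->
     halts c T s (fun s' => I s' /\ (mu s' < mu s)%N)) ->
  I s0 -> (mu s0 <= m)%N ->
  halts (While b c) (m * (T + (bcost b).+1) + (bcost b).+1) s0
    (fun s' => I s' /\ ~~ beval s' b).
Proof.
move=> body I0 mu0.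
have := @halts_while_aux b c (fun s => unchanged c s0 s /\ I s) mu T m s0.
move=> H; apply: halts_weaken (H _ _ mu0) (leqnn _) _ => //.
- move=> s [us Is] bs; apply: halts_weaken (halts_frame (body s us Is bs)) (leqnn _) _.
  by move=> s' [[Is' mus'] us']; split => //; split => //; exact: unchanged_trans us'.
- by move=> s' [[_ Is'] bs'].
Qed.

End Logic.

Definition IVar a := IGet a (IConst 0).
Definition RVar a := RGet a (IConst 0).
Definition ILt e1 e2 := BILe (IAdd e1 (IConst 1)) e2.
Definition IInc a := ISet a (IConst 0) (IAdd (IVar a) (IConst 1)).

Definition For a e c :=
  Seq (ISet a (IConst 0) (IConst 0))
      (While (ILt (IVar a) e) (Seq c (IInc a))).

(** The body has to establish [I i.+1] for the store with the counter already raised, since [I] may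
    depend on the whole store. Initialisation costs 3, each test [icost e + 6], each increment 6;
    the 13 is rounded up. *)
Lemma halts_for (R : realType) a e c (I : nat -> store R -> Prop) N T s :
  a \notin imod c ->
  (forall s', unchanged (For a e c) s s' -> ieval s' e = N) ->
  (forall i s', (i < N)%N -> unchanged (For a e c) s s' -> imem s' a 0 = i ->
     I i s' ->
     halts c T s' (fun s' => I i.+1 (Store (update (imem s') a 0 i.+1) (rmem s')))) ->
  I 0 (Store (update (imem s) a 0 0) (rmem s)) ->
  halts (For a e c) (N * (T + icost e + 13) + icost e + 9) s (I N).
Proof.
move=> ac eN body I0.
have [e1 [t1 [ex1 l1 q1]]] :
  halts (ISet a (IConst 0) (IConst 0)) 3 s
    (fun s1 => s1 = Store (update (imem s) a 0 0) (rmem s)) by exact: halts_run.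
set s1 := Store _ _ in I0 q1; rewrite {}q1 in ex1.
have lift s' : unchanged (Seq c (IInc a)) s1 s' -> unchanged (For a e c) s s'.
  move=> [iu ru]; split=> b; last exact: ru.
  rewrite /= inE mem_cat !negb_or => /and3P[ba bc _].
  rewrite iu /=; last by rewrite mem_cat inE negb_or bc.
  by rewrite /update (negbTE ba).
have := @halts_while R (ILt (IVar a) e) (Seq c (IInc a))
  (fun s => exists i, [/\ (i <= N)%N, imem s a 0 = i & I i s])
  (fun s => N - imem s a 0)%N (T + 6) N s1.
have -> : (bcost (ILt (IVar a) e)).+1 = (icost e + 6)%N by rewrite /=; lia.
case.
- move=> s' us' [i [iN ia Ii]] /=; rewrite ia eN ?addn1; last exact: lift.
  move=> lt_iN; apply: halts_seq; first exact: halts_frame (body _ _ lt_iN (lift _ us') ia Ii).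
  move=> s2 [Ii' [u2 _]]; apply: halts_run => //=.
  rewrite (u2 a ac) ia addn1; split; first by exists i.+1; rewrite /update !eqxx.
  by rewrite /update !eqxx /=; lia.
- by exists 0; rewrite /s1 /= /update !eqxx.
- by rewrite leq_subr.
move=> s2 [t2 [ex2 l2 [[i [iN ia Ii]] /= iN']]].
have us2 : unchanged (For a e c) s s2 by apply: lift; exact: exec_unchanged ex2.
exists s2, (t1 + t2)%N; split.
- exact: exec_seq ex1 ex2.
- by move: (icost e) l1 l2 => y; nia.
- by move: iN'; rewrite ia eN // addn1 -leqNgt => Ni; have -> : N = i by lia.
Qed.

(** * Integrals of piecewise affine functions *)

Section Integrals.
Variable R : realType.
Implicit Types (f g : R -> R) (a b c : R).
Import numFieldNormedType.Exports.
Local Notation mu := (@lebesgue_measure R).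

Lemma integrable_continuous f a b :
  continuous f -> mu.-integrable `[a, b]%classic (EFin \o f).
Proof.
move=> cf; apply: continuous_compact_integrable; first exact: segment_compact.
by apply: continuous_subspaceT.
Qed.

Lemma integral_split f a b c : continuous f -> a <= c -> c <= b ->
  \int[mu]_(t in `[a, b]%classic) f t =
  \int[mu]_(t in `[a, c]%classic) f t + \int[mu]_(t in `[c, b]%classic) f t.
Proof.
move=> cf ac cb.
have := @Rintegral_itvB R f (BLeft a) (BRight b) c (integrable_continuous a b cf).
rewrite !bnd_simp => /(_ ac cb).
rewrite Rintegral_itv_obnd_cbnd; last first.
  apply: integrableS (integrable_continuous c b cf) => //.
  by apply: subset_itvr; rewrite bnd_simp.
by move=> <-; rewrite addrC subrK.
Qed.

Lemma continuous_affine (x v : R) : continuous (fun t => x + v * t).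
Proof.
move=> t; apply: cvgD; first exact: cvg_cst.
by apply: cvgM; [exact: cvg_cst | exact: cvg_id].
Qed.

(** The midpoint rule is exact on affine functions, so the program can integrate a piece of an
    envelope with the four operations. *)
Lemma integral_affine (x v : R) a b : a <= b ->
  \int[mu]_(t in `[a, b]%classic) (x + v * t) =
  (b - a) * (x + v * ((a + b) / 2)).
Proof.
rewrite le_eqVlt => /predU1P[->|ab].
  by rewrite set_itv1 Rintegral_set1 subrr mul0r.
pose F t := x * t + v / 2 * (t * t).
have dF (t : R) : is_derive t (1 : R) F (x + v * t).
  apply: is_derive_eq.
  by rewrite /GRing.scale /=; field.
rewrite /Rintegral (@continuous_FTC2 R _ F) //=.
- by rewrite /F; field.
- exact/continuous_subspaceT/continuous_affine.
- have cF t : {for t, continuous F}.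
    apply: differentiable_continuous; apply/derivable1_diffP.
    by case: (dF t).
  split => [t _|  |]; first by case: (dF t).
  + by apply: cvg_at_right_filter; exact: cF.
  + by apply: cvg_at_left_filter; exact: cF.
- by move=> t _; rewrite derive1E; case: (dF t).
Qed.

Lemma integral_reverse f : continuous f ->
  \int[mu]_(t in `[0, 1]%classic) f (1 - t) =
  \int[mu]_(t in `[0, 1]%classic) f t.
Proof.
move=> cf; have r1 : 0 <= (1 : R) <= 1 by rewrite ler01 lexx.
have := Rintegration_by_substitution_onem r1 (continuous_subspaceT cf).
by rewrite unstable.onem1 => ->.
Qed.

Lemma continuous_bigmax (I : Type) (r : seq I) (P : pred I) (f0 : R -> R)
    (F : I -> R -> R) :
  continuous f0 -> (forall i, continuous (F i)) ->
  continuous (fun t => \big[Num.max/f0 t]_(i <- r | P i) F i t).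
Proof.
move=> cf0 cF; elim: r => [|i r IH] t.
  by under eq_fun do rewrite big_nil; exact: cf0.
under eq_fun do rewrite big_cons.
case: ifP => _; last exact: IH.
by apply: continuous_max; [exact: cF | exact: IH].
Qed.

Lemma continuous_bigmin (I : Type) (r : seq I) (P : pred I) (f0 : R -> R)
    (F : I -> R -> R) :
  continuous f0 -> (forall i, continuous (F i)) ->
  continuous (fun t => \big[Num.min/f0 t]_(i <- r | P i) F i t).
Proof.
move=> cf0 cF; elim: r => [|i r IH] t.
  by under eq_fun do rewrite big_nil; exact: cf0.
under eq_fun do rewrite big_cons.
case: ifP => _; last exact: IH.
by apply: continuous_min; [exact: cF | exact: IH].
Qed.

End Integrals.

(** * Merging clusters without a gap *)

Section Widths.
Variables (R : realType) (n : nat) (S : 'I_n -> trajectory R).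
Implicit Types (C D : {set 'I_n}) (t : R) (i : 'I_n).
Import numFieldNormedType.Exports.
Local Notation mu := (@lebesgue_measure R).
Local Notation pos i := (position (S i)).

Lemma continuous_position i : continuous (pos i).
Proof. exact: continuous_affine. Qed.

(** The same [pick] as in [diam], so that [width] is its integrand; the default 0 gives the empty
    cluster width 0. *)
Definition upper C t : R :=
  if [pick i in C] is Some i0 then \big[Num.max/pos i0 t]_(i in C) pos i t
  else 0.

Definition lower C t : R :=
  if [pick i in C] is Some i0 then \big[Num.min/pos i0 t]_(i in C) pos i t
  else 0.

Definition width C t : R := upper C t - lower C t.

Lemma continuous_upper C : continuous (upper C).
Proof.
rewrite /upper; case: pickP => [i0 _|_]; last by move=> t; exact: cvg_cst.
by apply: continuous_bigmax => [|i]; exact: continuous_position.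
Qed.

Lemma continuous_lower C : continuous (lower C).
Proof.
rewrite /lower; case: pickP => [i0 _|_]; last by move=> t; exact: cvg_cst.
by apply: continuous_bigmin => [|i]; exact: continuous_position.
Qed.

Lemma continuous_width C : continuous (width C).
Proof.
move=> t; apply: continuousB; [exact: continuous_upper|exact: continuous_lower].
Qed.

Lemma upper_ge C t i : i \in C -> pos i t <= upper C t.
Proof.
rewrite /upper; case: pickP => [i0 _|/(_ i) /= -> //] iC.
exact: (@le_bigmax_cond _ _ _ _ _ _ (fun i => pos i t)).
Qed.

Lemma lower_le C t i : i \in C -> lower C t <= pos i t.
Proof.
rewrite /lower; case: pickP => [i0 _|/(_ i) /= -> //] iC.
exact: (@bigmin_le_cond _ _ _ _ _ _ (fun i => pos i t)).
Qed.

Lemma upper_mem C t i : i \in C -> exists2 j, j \in C & upper C t = pos j t.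
Proof.
rewrite /upper; case: pickP => [i0 i0C|/(_ i) /= -> //] _.
elim/big_ind: _ => [|y z [j jC ->] [l lC ->]|j jC]; [by exists i0| |by exists j].
by rewrite maxEle; case: ifP => _; [exists l|exists j].
Qed.

Lemma lower_mem C t i : i \in C -> exists2 j, j \in C & lower C t = pos j t.
Proof.
rewrite /lower; case: pickP => [i0 i0C|/(_ i) /= -> //] _.
elim/big_ind: _ => [|y z [j jC ->] [l lC ->]|j jC]; [by exists i0| |by exists j].
by rewrite minEle; case: ifP => _; [exists j|exists l].
Qed.

Lemma width0 t : width finset.set0 t = 0.
Proof.
rewrite /width /upper /lower; case: pickP => [i|_]; first by rewrite inE.
by rewrite subrr.
Qed.

Lemma width_ge0 C t : 0 <= width C t.
Proof.
have [->|[i iC]] := finset.set_0Vmem C; first by rewrite width0.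
by rewrite subr_ge0 (le_trans (lower_le t iC)) ?upper_ge.
Qed.

Lemma diamE C : diam S C = \int[mu]_(t in `[0, 1]%classic) width C t.
Proof.
rewrite /diam /width /upper /lower; case: pickP => [i0 _|_] //.
by rewrite subrr Rintegral_cst// mul0r.
Qed.

Lemma diam0 : diam S finset.set0 = 0.
Proof. by rewrite /diam; case: pickP => // i; rewrite inE. Qed.

Lemma continuous_sum (I : Type) (r : seq I) (P : pred I) (F : I -> R -> R) :
  (forall c, continuous (F c)) -> continuous (fun t => \sum_(c <- r | P c) F c t).
Proof.
move=> cF; elim: r => [|c r IH] t.
  by under eq_fun do rewrite big_nil; exact: cvg_cst.
under eq_fun do rewrite big_cons.
case: ifP => _; last exact: IH.
by apply: continuousD; [exact: cF|exact: IH].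
Qed.

Lemma integral_sum (I : Type) (r : seq I) (P : pred I) (F : I -> R -> R) :
  (forall c, continuous (F c)) ->
  \int[mu]_(t in `[0, 1]%classic) (\sum_(c <- r | P c) F c t) =
  \sum_(c <- r | P c) \int[mu]_(t in `[0, 1]%classic) F c t.
Proof.
move=> cF; elim: r => [|c r IH].
  under eq_Rintegral do rewrite big_nil.
  by rewrite Rintegral_cst// mul0r big_nil.
under eq_Rintegral do rewrite big_cons.
rewrite big_cons; case: ifP => _; rewrite -IH //.
rewrite RintegralD //; apply: integrable_continuous; first exact: cF.
exact: continuous_sum.
Qed.

Lemma diam_le_sum D (I : finType) (P : pred I) (F : I -> {set 'I_n}) :
  (forall t, 0 <= t <= 1 -> width D t <= \sum_(c | P c) width (F c) t) ->
  diam S D <= \sum_(c | P c) diam S (F c).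
Proof.
move=> wD; rewrite diamE; under [leRHS]eq_bigr do rewrite diamE.
rewrite -integral_sum; last by move=> c; exact: continuous_width.
apply: le_Rintegral => //.
- by apply: integrable_continuous; exact: continuous_width.
- by apply: integrable_continuous; apply: continuous_sum => c; exact: continuous_width.
Qed.

(* A gap at time [t] just above trajectory [i0]. *)
Definition gap (I : finType) (P : pred I) (F : I -> {set 'I_n}) t i0 : Prop :=
  [/\ exists2 c, P c & i0 \in F c,
      exists c i, [/\ P c, i \in F c & pos i0 t < pos i t]
    & forall c, P c -> (forall i, i \in F c -> pos i t <= pos i0 t) \/
                       (forall i, i \in F c -> pos i0 t < pos i t)].

(* Without a gap, the intervals spanned by the clusters chain up from any of
   them to the topmost trajectory: induction from the top down. *)
Lemma no_gap_width (I : finType) (P : pred I) (F : I -> {set 'I_n}) t :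
  (forall i0, ~ gap P F t i0) ->
  width (\bigcup_(c | P c) F c)%SET t <= \sum_(c | P c) width (F c) t.
Proof.
move=> nogap; set D := (\bigcup_(c | P c) F c)%SET.
have sum_ge0 (Q : pred I) : 0 <= \sum_(c | Q c) width (F c) t.
  by apply: sumr_ge0 => c _; exact: width_ge0.
have [->|[z zD]] := finset.set_0Vmem D; first by rewrite width0.
(* Induction on the number of clusters that reach higher than [c]. Restricting the sum to tops not
   below that of [c] ensures that no width is counted twice along the chain. *)
have chain (m : nat) c i :
    (#|[set c' | P c' & (upper (F c) t < upper (F c') t)%R]%SET| <= m)%N ->
    P c -> i \in F c -> upper D t - lower (F c) t <=
    \sum_(c' | P c' && (upper (F c) t <= upper (F c') t)) width (F c') t.
  elim: m c i => [|m IH] c i cm Pc ic; have [h hc hE] := upper_mem t ic;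
    have [/existsP[c' /andP[Pc' /existsP[u /andP[uc' hu]]]]|] :=
      boolP [exists c', P c' && [exists u, (u \in F c') && (pos h t < pos u t)]].
  - have := card0_eq (eqP (etrans (esym (leqn0 _)) cm)) c'.
    by rewrite !inE Pc' hE (lt_le_trans hu) ?upper_ge.
  - move=> /existsPn hmax; rewrite (bigD1 c) ?Pc ?lexx //=.
    rewrite -[leLHS]addr0 lerD //.
    rewrite lerD2r; have [w wD ->] := upper_mem t zD.
    have /bigcupP[c' Pc' wc'] := wD.
    have := hmax c'; rewrite Pc' /= => /existsPn /(_ w).
    by rewrite wc' /= -leNgt hE.
  (* There is no gap just above [h], the top of [c], although something lies higher; so some cluster
     has members on both sides and continues the chain. *)
  - have [c1 Pc1 [[u1 u1c1 hu1] [l lc1 lh]]] : exists2 c1, P c1 &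
        (exists2 u, u \in F c1 & pos h t < pos u t) /\
        (exists2 l, l \in F c1 & pos l t <= pos h t).
      apply: contrapT => no; apply: (nogap h); split; [by exists c|by exists c', u|].
      move=> c1 Pc1; have [/existsP[w /andP[wc1 hw1]]|/existsPn nw] :=
        boolP [exists w, (w \in F c1) && (pos h t < pos w t)].
        right=> l lc1; rewrite ltNge; apply/negP => lh; apply: no; exists c1 => //.
        by split; [exists w|exists l].
      by left=> l lc1; have := nw l; rewrite lc1 /= -leNgt.
    have cc1 : upper (F c) t < upper (F c1) t.
      by rewrite hE (lt_le_trans hu1) ?upper_ge.
    have {}IH := IH c1 u1 _ Pc1 u1c1.
    rewrite (bigD1 c) ?Pc ?lexx //=.
    have -> : upper D t - lower (F c) t = width (F c) t + (upper D t - upper (F c) t).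
      by rewrite /width; ring.
    rewrite lerD2l (@le_trans _ _ (upper D t - lower (F c1) t)) //.
      by rewrite lerD2l lerN2 hE (le_trans _ lh) ?lower_le.
    apply: le_trans (IH _) _.
      rewrite -ltnS (leq_trans _ cm) // proper_card //; apply/properP; split.
        by apply/fintype.subsetP => d; rewrite !inE => /andP[-> /=]; exact: lt_trans.
      by exists c1; rewrite !inE Pc1 ?cc1 ?ltxx.
    rewrite [leLHS]big_mkcond [leRHS]big_mkcond; apply: ler_sum => d _.
    case Pd : (P d) => //=.
    case: ifP => [c1d|_]; last by case: ifP => _ //; exact: width_ge0.
    rewrite (le_trans (ltW cc1) c1d) /=.
    case: eqP => // dc; move: c1d; rewrite dc leNgt cc1 //.
  - move=> /existsPn hmax; rewrite (bigD1 c) ?Pc ?lexx //=.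
    rewrite -[leLHS]addr0 lerD //.
    rewrite lerD2r; have [w wD ->] := upper_mem t zD.
    have /bigcupP[c' Pc' wc'] := wD.
    have := hmax c'; rewrite Pc' /= => /existsPn /(_ w).
    by rewrite wc' /= -leNgt hE.
have [w wD wE] := lower_mem t zD.
have /bigcupP[c Pc wc] := wD.
apply: le_trans (_ : upper D t - lower (F c) t <= _).
  by rewrite /width lerD2l lerN2 wE lower_le.
apply: le_trans (chain _ c w (leqnn _) Pc wc) _.
rewrite [leLHS]big_mkcondr; apply: ler_sum => d _.
by case: ifP => _ //; exact: width_ge0.
Qed.

End Widths.

(** * Cuts and labels *)

Section Cuts.
Variables (R : realType) (x v : nat -> R).

Definition place i (t : R) : R := x i + v i * t.

(* [0 / 0 = 0]: the pair [(a, a)] stands for time 0. *)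
Definition cut_time a b : R := (x b - x a) / (v a - v b).

(* Just after time [cut_time a b], trajectory [l] is not below [a]. *)
Definition above a b l : bool :=
  (place a (cut_time a b) <= place l (cut_time a b))
  && ~~ ((place l (cut_time a b) <= place a (cut_time a b))
         && ~~ (v a <= v l)).

(* Move the separation time back to the last crossing of an upper and a lower
   trajectory: there, the lexicographically lowest upper trajectory meets a
   lower one, so the pair of both encodes the cut. *)
Lemma cut_exists n (U L : pred 'I_n) t (u0 : 'I_n) :
  0 <= t -> U u0 ->
  (forall u l : 'I_n, U u -> L l -> place l t < place u t) ->
  exists a b : 'I_n, [/\ b = a \/ v b < v a, forall u : 'I_n, U u -> above a b u
    & forall l : 'I_n, L l -> ~~ above a b l].
Proof.
move=> t_ge0 Uu0 sep.
pose Q (p : 'I_n * 'I_n) := [&& U p.1, L p.2 & v p.2 < v p.1].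
(* Only pairs with a faster upper trajectory count: backwards in time, only these come together. The
   default 0 clips crossings that precede the time interval. *)
pose t0 := \big[Num.max/0]_(p | Q p) cut_time p.1 p.2.
have t0_ge0 : 0 <= t0 by exact: bigmax_ge_id.
have t0_cases : t0 = 0 \/ exists u l : 'I_n, [/\ U u, L l, v l < v u & t0 = cut_time u l].
  rewrite /t0; elim/big_ind: _ => [|y z hy hz|[u l] /and3P[/= Uu Ll vlu]].
  - by left.
  - by rewrite maxEle; case: ifP.
  - by right; exists u, l.
have cut_le (u l : 'I_n) : U u -> L l -> v l < v u -> cut_time u l <= t0.
  move=> Uu Ll vlu.
  have Qp : Q (u, l) by apply/and3P.
  exact: (@le_bigmax_cond _ _ _ 0 _ Q (fun p => cut_time p.1 p.2) Qp).
have cut_val (u l : 'I_n) : v l < v u -> place u (cut_time u l) = place l (cut_time u l).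
  by move=> vlu; rewrite /place /cut_time; field; lra.
have t0t : t0 <= t.
  have [->//|[u [l [Uu Ll vlu ->]]]] := t0_cases.
  have := sep u l Uu Ll; have := cut_val u l vlu; rewrite /place => e.
  by move=> h; rewrite leNgt; apply/negP => h'; nra.
have weak u l : U u -> L l -> place l t0 <= place u t0.
  move=> Uu Ll; have := sep u l Uu Ll; have [vlu|vul] := ltP (v l) (v u).
    have := cut_val u l vlu; have := cut_le u l Uu Ll vlu; rewrite /place.
    by move=> h1 h2 h3; nra.
  by rewrite /place => h; nra.
(* Pairs that meet at [t0] are separated just afterwards by their velocities, which is the
   tie-breaking rule of [above]. *)
have strict u l : U u -> L l -> place u t0 <= place l t0 -> v l < v u.
  move=> Uu Ll ul; rewrite ltNge; apply/negP => vul.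
  by have := sep u l Uu Ll; move: ul; rewrite /place => h1 h2; nra.
have [m Um mmin] : exists2 m, U m & forall u, U u -> place m t0 <= place u t0.
  by case: (@arg_minP _ _ _ u0 U (fun u : 'I_n => place u t0) Uu0) => m Um h; exists m.
pose U' u := U u && (place u t0 <= place m t0).
have U'm : U' m by rewrite /U' Um lexx.
have [a U'a amin] : exists2 a, U' a & forall u, U' u -> v a <= v u.
  by case: (@arg_minP _ _ _ m U' (fun u : 'I_n => v u) U'm) => a U'a h; exists a.
have /andP[Ua am] := U'a.
have [b [ba bt0]] : exists b : 'I_n, (b = a \/ v b < v a) /\ cut_time a b = t0.
  have [->|[u [l [Uu Ll vlu t0E]]]] := t0_cases.
    by exists a; split; [left|rewrite /cut_time !subrr mul0r].
  (* [a] is lowest among the upper trajectories at [t0], hence not above [u], which meets [l] there;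
     and it is not below [l] by [weak]. *)
  have al : place a t0 = place l t0.
    apply/eqP; rewrite eq_le (weak _ _ Ua Ll) andbT (le_trans am) // (le_trans (mmin _ Uu)) //.
    by rewrite t0E cut_val.
  have vla : v l < v a by apply: strict; rewrite ?al.
  exists l; split; first by right.
  have e : x l - x a = (v a - v l) * t0 by move: al; rewrite /place; lra.
  by rewrite /cut_time e; field; lra.
exists a, b; split=> // [u Uu|l Ll]; rewrite /above bt0.
- rewrite (le_trans am (mmin _ Uu)) /=; apply/negP => /andP[ua /negP]; apply.
  by apply: amin; rewrite /U' Uu (le_trans ua am).
- rewrite (weak _ _ Ua Ll) negb_and negbK /= -implybE.
  by apply/implyP => al; rewrite -ltNge strict.
Qed.

Fixpoint label (p a b : nat -> nat) (j : nat) (l : nat) : nat :=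
  if j is j'.+1 then
    if (label p a b j' l == p j') && above (a j') (b j') l then j
    else label p a b j' l
  else 0.

(** This makes any sequence of k - 1 cuts, sensible or not, produce labels below k. *)
Lemma label_le p a b j l : (label p a b j l <= j)%N.
Proof. by elim: j => //= j IH; case: ifP => // _; exact: leqW. Qed.

Lemma eq_label p a b p' a' b' j l :
  (forall i, (i < j)%N -> [/\ p i = p' i, a i = a' i & b i = b' i]) ->
  label p a b j l = label p' a' b' j l.
Proof.
elim: j => //= j IH H; have [-> -> ->] := H j (ltnSn j).
by rewrite IH // => i ij; apply: H; exact: ltnW.
Qed.

Variables (n : nat) (S : 'I_n -> trajectory R).
Hypothesis SE : forall i : 'I_n, S i = (x i, v i).

(** The last condition is what halves the table of pairs: in the order by velocity, [b] then comes
    no later than [a]. *)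
Definition valid_cut j (p a b : nat) : Prop :=
  [/\ (p <= j)%N, (a < n)%N, (b < n)%N & b = a \/ v b < v a].

Definition clusters k (f : nat -> nat) : 'I_k -> {set 'I_n} :=
  fun c => [set i : 'I_n | f i == c]%SET.

(** After [j] cuts, [g] is a clustering no worse than [C], and [pi] sends each of its clusters to
    the part that contains it. Surjectivity of [pi] counts empty clusters too; it makes [pi]
    bijective once there are k parts. *)
Lemma partial_labels k (C : 'I_k -> {set 'I_n}) j :
  (0 < n)%N -> is_clustering C -> (j < k)%N ->
  exists p a b : nat -> nat, exists (g : 'I_n -> 'I_k) (pi : 'I_k -> nat),
  [/\ forall i, (i < j)%N -> valid_cut i (p i) (a i) (b i),
      forall i : 'I_n, label p a b j i = pi (g i),
      forall c, (pi c <= j)%N,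
      forall q, (q <= j)%N -> exists c, pi c = q
    & sd S (fun c => [set i | g i == c]%SET) <= sd S C].
Proof.
move=> n_gt0 [Ccover Cdisj]; elim: j => [|j IH] jk.
  have Cex i : exists c, i \in C c.
    have : i \in [set: 'I_n]%SET by rewrite inE.
    by rewrite -Ccover => /bigcupP[c _ ic]; exists c.
  pose g i := xchoose (Cex i).
  exists (fun=> 0), (fun=> 0), (fun=> 0), g, (fun=> 0); split=> //.
    by move=> q; rewrite leqn0 => /eqP ->; exists (Ordinal jk).
  rewrite le_eqVlt /sd; apply/orP; left; apply/eqP; apply: eq_bigr => c _.
  congr diam; apply/setP => i; rewrite inE.
  apply/eqP/idP => [<-|ic]; first exact: (xchooseP (Cex i)).
  apply/eqP/negPn/negP => /Cdisj /pred0P /(_ i) /=.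
  by rewrite ic (xchooseP (Cex i)).
have [p [a [b [g [pi [pv lE pi_le pi_surj cost]]]]]] := IH (ltnW jk).
have step q a' b' (g' : 'I_n -> 'I_k) (pi' : 'I_k -> nat) : valid_cut j q a' b' ->
    (forall i : 'I_n, (if (pi (g i) == q) && above a' b' i then j.+1 else pi (g i))
       = pi' (g' i)) ->
    (forall c, (pi' c <= j.+1)%N) ->
    (forall q', (q' <= j.+1)%N -> exists c, pi' c = q') ->
    sd S (fun c => [set i | g' i == c]%SET) <= sd S (fun c => [set i | g i == c]%SET) ->
    exists p a b : nat -> nat, exists (g : 'I_n -> 'I_k) (pi : 'I_k -> nat),
  [/\ forall i, (i < j.+1)%N -> valid_cut i (p i) (a i) (b i),
      forall i : 'I_n, label p a b j.+1 i = pi (g i),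
      forall c, (pi c <= j.+1)%N,
      forall q, (q <= j.+1)%N -> exists c, pi c = q
    & sd S (fun c => [set i | g i == c]%SET) <= sd S C].
  move=> qv E pi'_le pi'_surj le'.
  exists (fun i => if i == j then q else p i), (fun i => if i == j then a' else a i),
    (fun i => if i == j then b' else b i), g', pi'; split => //.
  - move=> i; rewrite ltnS leq_eqVlt; case: eqP => [->//|_ /=]; exact: pv.
  - move=> i; rewrite /= eqxx -E -lE (@eq_label _ _ _ p a b) // => i' i'j.
    by rewrite (ltn_eqF i'j).
  - exact: le_trans cost.
(* Pigeonhole: k clusters lie in [j.+1 < k] parts, so some part [q] holds two of them and is the one
   to cut. *)
have [c1 [c2 [c12 c2E]]] : exists c1 c2 : 'I_k, c1 != c2 /\ pi c1 = pi c2.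
  have /injectivePn[c1 [c2 c12 E]] :
      ~~ injectiveb (fun c => inord (pi c) : 'I_j.+1).
    apply/negP => /injectiveP /leq_card; rewrite !card_ord => kj.
    by rewrite leqNgt jk in kj.
  exists c2, c1; rewrite eq_sym; split => //.
  by have /(congr1 (@nat_of_ord _)) := E; rewrite !inordK ?ltnS ?pi_le // => ->.
pose q := pi c1; pose P c := pi c == q; pose F c := [set i | g i == c]%SET.
have posE (i : 'I_n) t : position (S i) t = place i t by rewrite SE.
have surj' (pi' : 'I_k -> nat) (c0 d0 : 'I_k) : pi' d0 = q -> pi' c0 = j.+1 ->
    (forall c, pi c != q -> pi' c = pi c) ->
    forall q', (q' <= j.+1)%N -> exists c, pi' c = q'.
  move=> d0E c0E H q'; rewrite leq_eqVlt => /predU1P[->|]; first by exists c0.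
  rewrite ltnS => /pi_surj [c cE]; have [cq|cq] := eqVneq (pi c) q.
    by exists d0; rewrite d0E -cq.
  by exists c; rewrite H.
have [[t [/andP[t0 t1] [i0 [[d0 Pd0 i0d0] [c0 [u0 [Pc0 u0c0 iu0]]] halves]]]]|nogap] :=
  pselect (exists t, 0 <= t <= 1 /\ exists i0, gap S P F t i0).
(* The gap splits no cluster of the part: [g] is kept, and the clusters entirely above [i0] move to
   the new part [j.+1]. *)
- pose U (i : 'I_n) := (pi (g i) == q) && (place i0 t < place i t).
  pose L (i : 'I_n) := (pi (g i) == q) && (place i t <= place i0 t).
  have Uu0 : U u0.
    rewrite /U -!posE iu0 andbT; move: u0c0; rewrite inE => /eqP ->; exact: Pc0.
  have [|a' [b' [ab' Ua Lb]]] := @cut_exists n U L t u0 t0 Uu0.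
    by move=> u l /andP[_ h1] /andP[_ h2]; exact: le_lt_trans h1.
  pose pi' (c : 'I_k) := if P c && [forall i, (i \in F c) ==> (place i0 t < place i t)]
                then j.+1 else pi c.
  apply: (step q a' b' g pi').
  + split; [exact: pi_le|exact: ltn_ord|exact: ltn_ord|].
    by case: ab' => [->|]; [left|right].
  + move=> i; rewrite /pi' /P; case: (pi (g i) =P q) => //= giq.
    have Fi : i \in F (g i) by rewrite inE.
    have [|h|h] := halves (g i); first exact/eqP.
    * have Li : L i by rewrite /L giq eqxx -!posE h.
      rewrite (negbTE (Lb _ Li)).
      case: ifP => // /forallP /(_ i); rewrite Fi /=.
      by have /andP[_] := Li; rewrite leNgt => /negbTE ->.
    * have Ui : U i by rewrite /U giq eqxx -!posE h.
      rewrite Ua //; case: forallP => // -[] i'; apply/implyP => /h.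
      by rewrite !posE.
  + by move=> c; rewrite /pi'; case: ifP => // _; exact: leqW.
  + apply: (surj' pi' c0 d0).
    * rewrite /pi'; case: ifP => [/andP[_ /forallP /(_ i0)]|_]; last exact/eqP.
      by rewrite i0d0 ltxx.
    * rewrite /pi' Pc0; case: forallP => // -[] i'; apply/implyP.
      have [h|h] := halves c0 Pc0; last by rewrite -!posE; exact: h.
      by have := h _ u0c0; rewrite leNgt iu0.
    * by move=> c cq; rewrite /pi' /P (negbTE cq).
  + exact: lexx.
- have [m _ mmin] : exists2 m : 'I_n, true & forall u : 'I_n, true -> x m <= x u.
    by case: (@arg_minP _ _ _ (Ordinal n_gt0) predT (fun u : 'I_n => x u) isT) => m Um h; exists m.
  (* The idle cut, with nothing below it. The part, merged into [c1], becomes part [j.+1]; its other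
     clusters, now empty and including [c2], remain in part [q]. *)
  have [|a' [b' [ab' Ua _]]] := @cut_exists n predT pred0 0 m (lexx _) isT => //.
  pose g' (i : 'I_n) : 'I_k := if pi (g i) == q then c1 else g i.
  pose pi' (c : 'I_k) := if c == c1 then j.+1 else pi c.
  apply: (step q a' b' g' pi').
  + split; [exact: pi_le|exact: ltn_ord|exact: ltn_ord|].
    by case: ab' => [->|]; [left|right].
  + move=> i; rewrite Ua // andbT /g' /pi'; case: ifP => [_|giq]; rewrite ?eqxx //.
    by have [gi|//] := eqVneq (g i) c1; rewrite gi eqxx in giq.
  + by move=> c; rewrite /pi'; case: ifP => // _; exact: leqW.
  + apply: (surj' pi' c1 c2).
    * by rewrite /pi' eq_sym (negbTE c12) -c2E.
    * by rewrite /pi' eqxx.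
    * by move=> c cq; rewrite /pi'; case: (eqVneq c c1) cq => // ->; rewrite eqxx.
  + rewrite /sd (bigID P) [leRHS](bigID P) /=; apply: lerD; last first.
      rewrite le_eqVlt; apply/orP; left; apply/eqP; apply: eq_bigr => c Pc.
      congr diam; apply/setP => i; rewrite !inE /g'; case: ifP => // giq.
      have -> : (c1 == c) = false by apply/negbTE; move: Pc; apply: contra => /eqP <-; exact: eqxx.
      by apply/esym/negbTE; move: Pc; apply: contra => /eqP <-.
    rewrite (bigD1 c1) /=; last exact: eqxx.
    rewrite big1 ?addr0; last first.
      move=> c /andP[Pc cc1]; rewrite (_ : [set _ | _]%SET = finset.set0) ?diam0 //.
      apply/setP => i; rewrite !inE /g'; case: ifP => [_|giq].
        by rewrite eq_sym (negbTE cc1).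
      by apply/negbTE; move: giq; apply: contraFN => /eqP ->.
    have -> : [set i | g' i == c1]%SET = (\bigcup_(c | P c) F c)%SET.
      apply/setP => i; rewrite inE; apply/eqP/bigcupP; rewrite /g'.
        case: ifP => [giq _|giq gi]; first by exists (g i) => //; rewrite inE.
        by move: giq; rewrite gi /q eqxx.
      by move=> [c Pc]; rewrite inE => /eqP ->; rewrite -/(P c) Pc.
    apply: diam_le_sum => t t01; apply: no_gap_width => i0 gapi0; apply: nogap.
    by exists t; split => //; exists i0.
Qed.

(** After k - 1 cuts there are as many parts as clusters, so the surjection [pi] is a renumbering
    and preserves the cost. *)
Lemma labels_optimal k (C : 'I_k -> {set 'I_n}) :
  (0 < n)%N -> (0 < k)%N -> is_clustering C ->
  exists p a b : nat -> nat,
    (forall i, (i < k.-1)%N -> valid_cut i (p i) (a i) (b i)) /\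
    sd S (@clusters k (label p a b k.-1)) <= sd S C.
Proof.
move=> n_gt0 k_gt0 Ccl.
have [|p [a [b [g [pi [pv lE pi_le pi_surj cost]]]]]] :=
  @partial_labels k C k.-1 n_gt0 Ccl; first by rewrite prednK.
exists p, a, b; split => //; apply: le_trans cost.
have pi_lt c : (pi c < k)%N by rewrite -(prednK k_gt0) ltnS.
pose s c := Ordinal (pi_lt c).
have s_surj : forall c, exists c', s c' = c.
  move=> c; have [|c' c'E] := pi_surj c; first by rewrite -ltnS prednK.
  by exists c'; apply: val_inj.
have [s' ss'] := fin_all_exists s_surj.
have s_inj := can_inj (canF_sym ss').
rewrite /sd (reindex_inj s_inj) /= le_eqVlt; apply/orP; left; apply/eqP.
apply: eq_bigr => c _; congr diam; apply/setP => i; rewrite !inE lE /=.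
apply/eqP/eqP => [e|-> //]; apply: s_inj; exact: val_inj.
Qed.

End Cuts.

(** * Envelopes by a stack of lines *)

Section EnvelopeStack.
Variables (R : realType) (x v : nat -> R).
Import numFieldNormedType.Exports.
Local Notation mu := (@lebesgue_measure R).
Local Notation place := (place x v).
Implicit Types (A : nat -> Prop) (cur : option nat).

Definition segment l (a b : R) : R := (b - a) * (x l + v l * ((a + b) / 2%:R)).

Lemma segmentE l a b : a <= b ->
  \int[mu]_(t in `[a, b]%classic) place l t = segment l a b.
Proof. exact: integral_affine. Qed.

Definition dominates A l (t : R) : Prop := forall a, A a -> place a t <= place l t.

(* Entry [j < m] of the stack is the line [sl j], on top from time [ss j] on;
   [sp j] is the integral of the envelope of [A] up to [ss j].  The stack
   describes this envelope up to time [e]; after time [e], the envelope is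
   below the line [cur] that is being inserted. *)
Definition stack_inv A cur m (e : R) (sl : nat -> nat) (ss sp : nat -> R) : Prop :=
  [/\ 0 <= e <= 1,
      m = 0 -> e = 0 \/ forall a, ~ A a,
      (0 < m)%N -> ss 0 = 0 /\ sp 0 = 0,
      forall j, (j < m)%N -> [/\ A (sl j), ss j <= e
        & forall t, ss j <= t <= (if (j.+1 < m)%N then ss j.+1 else e) ->
            dominates A (sl j) t]
    & (forall j, (j.+1 < m)%N -> ss j <= ss j.+1 /\
        sp j.+1 = sp j + segment (sl j) (ss j) (ss j.+1)) /\
      (e = 1 \/ exists l, cur = Some l /\
         forall t, e <= t <= 1 -> dominates A l t)].

(** With [None] the stack already describes the envelope up to time 1, whatever is inserted next. *)
Lemma stack_inv_next A m e sl ss sp cur :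
  stack_inv A None m e sl ss sp -> stack_inv A cur m e sl ss sp.
Proof.
move=> [h1 h2 h3 h4 [h5 h6]]; split => //; split => //.
by case: h6 => [|[l [//]]]; left.
Qed.

Lemma stack_inv_empty A cur sl ss sp : (forall a, ~ A a) ->
  stack_inv A cur 0 1 sl ss sp.
Proof.
move=> A0; split; rewrite ?ler01 ?lexx //; first by right.
by split; [|left].
Qed.

(** Being at least as steep as the top and not below it where its piece starts, [l] stays above it
    from there on. The top's piece is given up, and the stack ends at [ss m]. *)
Lemma stack_pop A l m e sl ss sp :
  stack_inv A (Some l) m.+1 e sl ss sp -> v (sl m) <= v l ->
  place (sl m) (ss m) <= place l (ss m) ->
  stack_inv A (Some l) m (ss m) sl ss sp.
Proof.
move=> [e01 _ h3 h4 [h5 h6]] vml above.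
have [ss0 sp0] := h3 isT.
have [Am sme dom] := h4 m (ltnSn m).
have incr j : (j <= m)%N -> 0 <= ss j.
  elim: j => [|j IH] jm; first by rewrite ss0.
  by rewrite (le_trans (IH (ltnW jm))) //; have [] := h5 j jm.
have incr2 d j : (j + d <= m)%N -> ss j <= ss (j + d)%N.
  elim: d => [|d IH]; first by rewrite addn0.
  rewrite addnS => jm; rewrite (le_trans (IH (ltnW jm))) //.
  by have [] := h5 _ (jm : ((j + d).+1 < m.+1)%N).
split.
- by rewrite incr //= (le_trans sme) //; case/andP: e01.
- by move=> ->; left.
- by [].
- move=> j jm; have [Aj sje domj] := h4 j (ltnW jm); split => //.
    by have := incr2 (m - j)%N j; rewrite subnKC ?(ltnW jm) //; apply.
  move=> t; case: ifP => jm1 ht; apply: domj; first by rewrite ltnS (ltnW jm1).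
  have mE : m = j.+1 by lia.
  by rewrite -mE ltnSn.
- split; first by move=> j jm; apply: h5; exact: ltnW.
  right; exists l; split => // t /andP[smt t1] a Aa.
  have lem : place (sl m) t <= place l t by move: above; rewrite /place; nra.
  have [te|et] := leP t e.
    by apply: le_trans lem; apply: dom => //; rewrite ltnn smt.
  have [e1|[l' [[<-] dl]]] := h6; first by rewrite e1 ltNge t1 in et.
  by apply: dl => //; rewrite ltW.
Qed.

Lemma stack_top_le A l m e sl ss sp j t :
  stack_inv A (Some l) m.+1 e sl ss sp -> (j <= m)%N ->
  ss j <= t <= (if (j.+1 < m.+1)%N then ss j.+1 else e) ->
  place l t <= place (sl m) t -> place l t <= place (sl j) t.
Proof.
move=> [_ _ _ h4 _] jm jt /le_trans; apply.
by have [Am _ _] := h4 m (ltnSn m); have [_ _ dj] := h4 j jm; exact: dj.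
Qed.

(** Being at least as steep, a line not above the top at time 1 is never above it before. Past [e]
    it bounds [A], hence so does the top, and the stack reaches time 1 again. *)
Lemma stack_discard A l m e sl ss sp cur :
  stack_inv A (Some l) m.+1 e sl ss sp -> v (sl m) <= v l ->
  place l 1 <= place (sl m) 1 ->
  stack_inv (fun a => A a \/ a = l) cur m.+1 1 sl ss sp.
Proof.
move=> inv vml below; have below' t : t <= 1 -> place l t <= place (sl m) t.
  by move: below; rewrite /place; nra.
have [/andP[e0 e1] _ h3 h4 [h5 h6]] := inv; split.
- by rewrite ler01 lexx.
- by [].
- by [].
- move=> j jm; have [Aj sje dj] := h4 j jm; split; [by left|exact: le_trans e1|].
  move=> t jt; have t1 : t <= 1.
    by case/andP: jt => _ /le_trans; apply; case: ifP => // /h4 [_ /le_trans ->].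
  have [te|et] := leP t (if (j.+1 < m.+1)%N then ss j.+1 else e).
    have {}jt : ss j <= t <= (if (j.+1 < m.+1)%N then ss j.+1 else e).
      by rewrite te andbT; case/andP: jt.
    by move=> a [/(dj _ jt)//|->]; apply: (stack_top_le inv jm jt); exact: below'.
  have jmE : j = m.
    apply/eqP; rewrite eqn_leq -[(j <= m)%N]ltnS jm leqNgt -ltnS; apply/negP => jm1.
    by case/andP: jt => _; rewrite jm1 in et *; rewrite leNgt et.
  rewrite jmE ltnn in et *; move=> a [Aa|->]; last exact: below'.
  apply: (@le_trans _ _ (place l t)); last exact: below'.
  have [e1'|[l' [[<-] dl]]] := h6; first by rewrite e1' ltNge t1 in et.
  by apply: dl => //; rewrite t1 ltW.
- by split; [|left].
Qed.

(** The stack is empty either because [l] is the first line of the cluster or because pops have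
    brought [e] down to 0, where [l] dominates everything. *)
Lemma stack_push0 A l e sl ss sp sl' ss' sp' cur :
  stack_inv A (Some l) 0 e sl ss sp ->
  sl' 0 = l -> ss' 0 = 0 -> sp' 0 = 0 ->
  stack_inv (fun a => A a \/ a = l) cur 1 1 sl' ss' sp'.
Proof.
move=> [e01 /(_ erefl) Ae _ _ [_ h6]] sl0 ss0 sp0; split.
- by rewrite ler01 lexx.
- by [].
- by [].
- move=> [|//] _; rewrite sl0 ss0; split; [by right|exact: ler01|].
  move=> t /andP[t0 t1] a [Aa|->//].
  case: Ae => [e0|/(_ a Aa) //].
  have [e1|[l' [[<-] dl]]] := h6; last by apply: dl => //; rewrite e0 t0.
  by move: (@oner_eq0 R); rewrite -e1 e0 eqxx.
- by split; [|left].
Qed.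

(** [l] is below the top at the start of its piece and above it at time 1, so they cross in between.
    The piece of the top is closed there and its integral is added to the prefix sums. *)
Lemma stack_push A l m e sl ss sp s sl' ss' sp' cur :
  stack_inv A (Some l) m.+1 e sl ss sp -> v (sl m) <= v l ->
  place l (ss m) < place (sl m) (ss m) -> place (sl m) 1 < place l 1 ->
  s = (x (sl m) - x l) / (v l - v (sl m)) ->
  (forall j, (j < m.+1)%N -> [/\ sl' j = sl j, ss' j = ss j & sp' j = sp j]) ->
  sl' m.+1 = l -> ss' m.+1 = s ->
  sp' m.+1 = sp m + segment (sl m) (ss m) s ->
  stack_inv (fun a => A a \/ a = l) cur m.+2 1 sl' ss' sp'.
Proof.
move=> inv vml lo hi sE old sl1 ss1 sp1.
have [/andP[e0 e1] _ h3 h4 [h5 h6]] := inv.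
have [Am sme domm] := h4 m (ltnSn m).
have vlt : v (sl m) < v l.
  rewrite lt_neqAle vml andbT; apply/eqP => ve; move: lo hi; rewrite /place ve.
  by move=> lo hi; nra.
have cross : place l s = place (sl m) s by rewrite sE /place; field; lra.
have before t : t <= s -> place l t <= place (sl m) t.
  by move: cross; rewrite /place; nra.
have after t : s <= t -> place (sl m) t <= place l t.
  by move: cross; rewrite /place; nra.
have sms : ss m <= s by rewrite leNgt; apply/negP => /ltW/after; rewrite leNgt lo.
have s1 : s <= 1 by rewrite leNgt; apply/negP => /ltW/before; rewrite leNgt hi.
(* Past [e] the new line dominates [A], the top included, so the crossing cannot come later. *)
have se : s <= e.
  have [-> //|[l' [[<-] dl]]] := h6.
  have := dl e; rewrite lexx e1 => /(_ isT _ Am) h.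
  rewrite leNgt; apply/negP => es; move: h cross; rewrite /place => h c.
  by nra.
have old' j : (j <= m)%N -> [/\ sl' j = sl j, ss' j = ss j & sp' j = sp j] by exact: old.
split.
- by rewrite ler01 lexx.
- by [].
- by have [_ -> ->] := old 0 isT; exact: h3.
- move=> j; rewrite ltnS leq_eqVlt => /predU1P[->|jm].
    rewrite ltnn sl1 ss1; split; [by right|by []|] => t /andP[st t1] a [Aa|->//].
    have [te|et] := leP t e.
      apply: le_trans (after _ st); apply: domm => //.
      by rewrite ltnn te (le_trans sms).
    have [e1'|[l' [[<-] dl]]] := h6; first by rewrite e1' ltNge t1 in et.
    by apply: dl => //; rewrite t1 ltW.
  have [Aj sje dj] := h4 j jm; have [-> -> _] := old j jm.
  split; [by left|exact: le_trans e1|] => t.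
  rewrite ltnS jm => jt.
  have {}jt : ss j <= t <= (if (j.+1 < m.+1)%N then ss j.+1 else e) /\ (t <= s).
    move: jt; move: (jm); rewrite ltnS leq_eqVlt => /predU1P[->|jm1].
      by rewrite ss1 ltnn => /andP[-> ts]; rewrite (le_trans ts).
    have [_ -> _] := old j.+1 jm1; rewrite ltnS jm1 => /andP[-> tj]; split => //.
    apply: le_trans tj _; apply: le_trans sms.
    have incr2 d : (j.+1 + d <= m)%N -> ss j.+1 <= ss (j.+1 + d)%N.
      elim: d => [|d IH]; first by rewrite addn0.
      rewrite addnS => jd; rewrite (le_trans (IH (ltnW jd))) //.
      by have [] := h5 _ (jd : ((j.+1 + d).+1 < m.+1)%N).
    by have := incr2 (m - j.+1)%N; rewrite subnKC //; apply.
  move=> a [Aa|->]; first by apply: dj => //; case: jt.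
  exact: (stack_top_le inv jm (proj1 jt) (before _ (proj2 jt))).
- split; last by left.
  move=> j; rewrite ltnS leq_eqVlt => /predU1P[[->]|jm].
    by have [-> -> ->] := old m (ltnSn m); rewrite ss1 sp1.
  have [-> -> ->] := old j (ltnW jm); have [_ -> ->] := old _ jm; exact: h5.
Qed.

(** [M] is any continuous function that is the maximum of the lines, so that the lemma serves the
    upper envelope and the reversed, negated lower one alike. *)
Lemma stack_integral A (M : R -> R) m e sl ss sp :
  stack_inv A None m.+1 e sl ss sp ->
  continuous M -> (forall t, 0 <= t <= 1 -> forall a, A a -> place a t <= M t) ->
  (forall t, 0 <= t <= 1 -> exists2 a, A a & M t = place a t) ->
  \int[mu]_(t in `[0, 1]%classic) M t = sp m + segment (sl m) (ss m) 1.
Proof.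
move=> [_ _ h3 h4 [h5 h6]] cM Mge Mex.
have e1 : e = 1 by case: h6 => // -[l []].
have [ss0 sp0] := h3 isT.
have ss_ge0 j : (j <= m)%N -> 0 <= ss j.
  elim: j => [|j IH] jm; first by rewrite ss0.
  by rewrite (le_trans (IH (ltnW jm))) //; have [] := h5 j jm.
have piece j b : (j <= m)%N -> ss j <= b ->
    b <= (if (j.+1 < m.+1)%N then ss j.+1 else e) -> b <= 1 ->
    \int[mu]_(t in `[ss j, b]%classic) M t = segment (sl j) (ss j) b.
  move=> jm sjb bb b1; rewrite -segmentE //; apply: eq_Rintegral => t.
  rewrite inE /= in_itv /= => /andP[sjt tb].
  have t01 : 0 <= t <= 1 by rewrite (le_trans (ss_ge0 j jm) sjt) (le_trans tb b1).
  have [Aj _ dj] := h4 j jm; apply/eqP; rewrite eq_le Mge // andbT.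
  by have [a Aa ->] := Mex t t01; apply: dj; rewrite // sjt (le_trans tb).
have prefix j : (j <= m)%N ->
    \int[mu]_(t in `[0, ss j]%classic) M t = sp j.
  elim: j => [|j IH] jm; first by rewrite ss0 sp0 set_itv1 Rintegral_set1.
  have [sj ->] := h5 j jm.
  rewrite (integral_split cM (ss_ge0 _ (ltnW jm)) sj) IH ?(ltnW jm) //.
  have [_ sje _] := h4 _ (jm : (j.+1 < m.+1)%N).
  by rewrite piece ?ltnS ?jm ?(ltnW jm) // -e1.
have [_ sme _] := h4 m (ltnSn m).
rewrite (integral_split cM (ss_ge0 m (leqnn m)) (_ : ss m <= 1)) -?e1 //.
by rewrite prefix // piece ?ltnn ?e1 // -e1.
Qed.

End EnvelopeStack.

(** * The program *)

Definition IEq e1 e2 := BAnd (BILe e1 e2) (BILe e2 e1).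
(* Integer arrays: 2 the trajectories sorted by velocity; 6 and 7 the pairs
   that encode the cuts, 10 their number; 11 and 12 bounds and digits of the
   odometer; 13 labels; 19 the stack of the envelope, of height 18; 16 current
   cluster; 20 search flag; 21 whether array 1 holds a clustering yet; the
   others are counters.  Real arrays: 2 and 3 time and height of the current
   cut; 4 and 5 starting times and prefix integrals of the stack; 6 cost of the
   labels; 7 cost of array 1; 8 a crossing time. *)

(* With [flip], trajectory [x + v t] is replaced by its negated time reversal
   [- (x + v (1 - t)) = - (x + v) + v t], so that the order by velocity is
   kept and lower envelopes become upper envelopes. *)
Definition intercept (flip : bool) (l : iexp) : rexp :=
  if flip then RSub (RConst 0) (RAdd (RGet 0 l) (RGet 1 l)) else RGet 0 l.

Definition place_exp flip l t := RAdd (intercept flip l) (RMul (RGet 1 l) t).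

Definition segment_exp flip l a b :=
  RMul (RSub b a)
    (RAdd (intercept flip l) (RMul (RGet 1 l) (RDiv (RAdd a b) (RConst 2)))).

Definition current := IGet 2 (IVar 3).
Definition below_top := ISub (IVar 18) (IConst 1).

(** A pop leaves counter 3 in place, so that the same trajectory is compared with the next entry of
    the stack; every other branch moves on. *)
Definition envelope_step flip : cmd :=
  If (IEq (IGet 13 current) (IVar 16))
   (If (BILe (IVar 18) (IConst 0))
     (Seq (ISet 19 (IConst 0) current)
     (Seq (RSet 4 (IConst 0) (RConst 0))
     (Seq (RSet 5 (IConst 0) (RConst 0))
     (Seq (IInc 18) (IInc 3)))))
     (If (BRLe (place_exp flip (IGet 19 below_top) (RGet 4 below_top))
               (place_exp flip current (RGet 4 below_top)))
       (ISet 18 (IConst 0) below_top)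
       (If (BRLe (place_exp flip current (RConst 1))
                 (place_exp flip (IGet 19 below_top) (RConst 1)))
         (IInc 3)
         (Seq (RSet 8 (IConst 0)
            (RDiv (RSub (intercept flip (IGet 19 below_top)) (intercept flip current))
                  (RSub (RGet 1 current) (RGet 1 (IGet 19 below_top)))))
         (Seq (RSet 5 (IVar 18) (RAdd (RGet 5 below_top)
            (segment_exp flip (IGet 19 below_top) (RGet 4 below_top) (RVar 8))))
         (Seq (RSet 4 (IVar 18) (RVar 8))
         (Seq (ISet 19 (IVar 18) current)
         (Seq (IInc 18) (IInc 3)))))))))
   (IInc 3).

Definition envelope_cmd flip : cmd :=
  Seq (ISet 3 (IConst 0) (IConst 0))
  (Seq (ISet 18 (IConst 0) (IConst 0))
  (Seq (While (ILt (IVar 3) (IGet 0 (IConst 0))) (envelope_step flip))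
    (If (BILe (IConst 1) (IVar 18))
       (RSet 6 (IConst 0) (RAdd (RVar 6)
          (RAdd (RGet 5 below_top)
             (segment_exp flip (IGet 19 below_top) (RGet 4 below_top) (RConst 1)))))
       Skip))).

Section EnvelopeProgram.
Variables (R : realType) (xs vs : nat -> R) (n : nat) (ord : nat -> nat).
Import numFieldNormedType.Exports.
Local Notation mu := (@lebesgue_measure R).

Definition line_intercept (flip : bool) i : R := if flip then 0 - (xs i + vs i) else xs i.

Hypothesis ord_lt : forall i, (i < n)%N -> (ord i < n)%N.
Hypothesis ord_surj : forall l, (l < n)%N -> exists2 i, (i < n)%N & ord i = l.
Hypothesis ord_mono : forall i j, (i <= j)%N -> (j < n)%N -> vs (ord i) <= vs (ord j).

Definition processed (f : nat -> nat) c i a : Prop :=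
  exists2 i', (i' < i)%N & ord i' = a /\ f a = c.

(** It is [None] at members of other clusters and at the end; there [stack_inv] forces [e = 1]. *)
Definition candidate (f : nat -> nat) c i : option nat :=
  if (i < n)%N && (f (ord i) == c) then Some (ord i) else None.

Lemma processedS_in f c i : f (ord i) = c ->
  processed f c i.+1 = fun a => processed f c i a \/ a = ord i.
Proof.
move=> fc; apply/funext => a; apply/propext; split.
  move=> [i' ]; rewrite ltnS leq_eqVlt => /predU1P[->|lt] [<- fa]; first by right.
  by left; exists i'.
move=> [[i' lt h]|->]; first by exists i' => //; exact: ltnW.
by exists i.
Qed.

Lemma processedS_out f c i : f (ord i) != c ->
  processed f c i.+1 = processed f c i.
Proof.
move=> /eqP fc; apply/funext => a; apply/propext; split.
  move=> [i' ]; rewrite ltnS leq_eqVlt => /predU1P[->|lt] [<- fa] //.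
  by exists i'.
by move=> [i' lt h]; exists i' => //; exact: ltnW.
Qed.

Lemma reval_intercept (s : store R) flip e : rmem s 0 = xs -> rmem s 1 = vs ->
  reval s (intercept flip e) = line_intercept flip (ieval s e).
Proof.
by move=> r0 r1; rewrite /intercept /line_intercept; case: flip; rewrite /= ?r0 ?r1.
Qed.

Lemma reval_place (s : store R) flip e t : rmem s 0 = xs -> rmem s 1 = vs ->
  reval s (place_exp flip e t) =
  place (line_intercept flip) vs (ieval s e) (reval s t).
Proof. by move=> r0 r1 /=; rewrite reval_intercept // r1. Qed.

Lemma reval_segment (s : store R) flip e a b : rmem s 0 = xs -> rmem s 1 = vs ->
  reval s (segment_exp flip e a b) =
  segment (line_intercept flip) vs (ieval s e) (reval s a) (reval s b).
Proof. by move=> r0 r1 /=; rewrite reval_intercept // r1. Qed.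

Lemma run_if (s : store R) b c1 c2 :
  run (If b c1 c2) s = if beval s b then run c1 s else run c2 s.
Proof. by []. Qed.

Lemma beval_rle (s : store R) e1 e2 : beval s (BRLe e1 e2) = (reval s e1 <= reval s e2).
Proof. by []. Qed.

Definition env_ready f c (s : store R) : Prop :=
  [/\ imem s 0 0 = n, imem s 2 = ord, imem s 13 = f & imem s 16 0 = c] /\
  rmem s 0 = xs /\ rmem s 1 = vs.

Definition env_inv flip f c (s : store R) : Prop :=
  env_ready f c s /\
  exists i e, [/\ imem s 3 0 = i, (i <= n)%N &
    stack_inv (line_intercept flip) vs (processed f c i) (candidate f c i)
      (imem s 18 0) e (imem s 19) (rmem s 4) (rmem s 5)].

(** Amortisation: moving on lowers the first term by 2 and raises the stack by at most 1, and a pop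
    lowers the stack by 1. Starting at 2n, there are at most 2n steps. *)
Definition env_potential (s : store R) : nat := 2 * (n - imem s 3 0) + imem s 18 0.

Lemma processed_slope f c i a : processed f c i a -> (i < n)%N -> vs a <= vs (ord i).
Proof. by move=> [i' lt [<- _]] lt_in; apply: ord_mono => //; exact: ltnW. Qed.

Lemma envelope_step_run flip f c s :
  env_inv flip f c s -> (imem s 3 0 < n)%N ->
  env_inv flip f c (run (envelope_step flip) s) /\
  (env_potential (run (envelope_step flip) s) < env_potential s)%N.
Proof.
move=> [[[s0 s2 s13 s16] [r0 r1]] [i [e [s3 lein inv]]]]; rewrite s3 => lt_in.
rewrite /env_potential s3.
have candE : (f (ord i) == c) -> candidate f c i = Some (ord i).
  by rewrite /candidate lt_in => ->.
have [fc|fc] := eqVneq (f (ord i)) c; last first.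
  have cond : beval s (IEq (IGet 13 current) (IVar 16)) = false.
    by rewrite /= s3 s2 s13 s16 -eqn_leq (negbTE fc).
  rewrite /envelope_step run_if cond.
  rewrite /= /update /= s3 addn1; split; last by lia.
  split; first by split.
  exists i.+1, e; split => //=; rewrite processedS_out //.
  apply: stack_inv_next; move: inv.
  by rewrite /candidate lt_in (negbTE fc).
rewrite candE ?fc // in inv.
have cond : beval s (IEq (IGet 13 current) (IVar 16)).
  by rewrite /= s3 s2 s13 s16 fc leqnn.
rewrite /envelope_step run_if cond run_if.
case s18 : (imem s 18 0) => [|m].
  rewrite /= s18 /= /update /= s3 s2 s18 ?add0n ?addn1; split; last by lia.
  split; first by split.
  exists i.+1, 1; split => //=; rewrite processedS_in //.
  by rewrite s18 in inv; apply: (stack_push0 _ inv).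
rewrite s18 in inv.
have slope : vs (imem s 19 m) <= vs (ord i).
  have [_ _ _ /(_ m (ltnSn m))[Am _ _] _] := inv.
  exact: processed_slope Am lt_in.
have btE : ieval s below_top = m by rewrite /= s18 subn1.
have curE : ieval s current = ord i by rewrite /= s3 s2.
have topE : ieval s (IGet 19 below_top) = imem s 19 m by rewrite /= s18 subn1.
have startE : reval s (RGet 4 below_top) = rmem s 4 m by rewrite /= s18 subn1.
have -> : beval s (BILe (IVar 18) (IConst 0)) = false by rewrite /= s18.
rewrite run_if beval_rle !reval_place // topE curE startE.
case: ifP => [above|/negbT]; last rewrite -ltNge => top_above.
  rewrite /= /update /= s18 s3 subn1 /=; split; last by lia.
  split; first by split.
  exists i, (rmem s 4 m); split => //=.
  by rewrite candE ?fc //; apply: stack_pop inv slope above.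
rewrite run_if beval_rle !reval_place // topE curE.
case: ifP => [below|/negbT]; last rewrite -ltNge => cur_above.
  rewrite /= /update /= s3 s18 addn1; split; last by lia.
  split; first by split.
  exists i.+1, 1; split => //=; rewrite processedS_in // s18.
  exact: stack_discard inv slope below.
have push := fun t sl' ss' sp' cur => @stack_push R (line_intercept flip) vs
  _ _ _ _ _ _ _ t sl' ss' sp' cur inv slope top_above cur_above.
case: flip inv push top_above cur_above => inv push _ _;
  rewrite /= /update /= s3 s18 s2 subn1 r0 r1 addn1 /=;
  (split; last by lia); (split; first by split);
  exists i.+1, 1; split => //=; rewrite processedS_in // addn1;
  apply: push; rewrite /= ?eqxx // => j jm; by rewrite (ltn_eqF jm).
Qed.

Lemma envelope_step_cost flip : (max_cost (envelope_step flip) <= 300)%N.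
Proof. by case: flip; vm_compute. Qed.

Lemma envelope_halts flip f c s (M : R -> R) :
  env_ready f c s -> continuous M ->
  (forall t, 0 <= t <= 1 -> forall a, (a < n)%N -> f a = c ->
     place (line_intercept flip) vs a t <= M t) ->
  (forall t, 0 <= t <= 1 -> forall a, (a < n)%N -> f a = c ->
     exists a, [/\ (a < n)%N, f a = c & M t = place (line_intercept flip) vs a t]) ->
  ((forall a, (a < n)%N -> f a <> c) ->
     \int[mu]_(t in `[0, 1]%classic) M t = 0) ->
  halts (envelope_cmd flip) (700 * n.+1) s
    (fun s' => rmem s' 6 0 = rmem s 6 0 + \int[mu]_(t in `[0, 1]%classic) M t).
Proof.
move=> ready cM Mge Mex M0.
(* Two initialisations, at most 2n steps of cost 300 with a test of cost 8, the failing test, and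
   the final addition. *)
apply: (@halts_weaken _ _ _ (3 + (3 + ((2 * n * (300 + 8) + 8) + 100)))); last 2 first.
- by lia.
- by move=> s'; exact.
apply: (@halts_seq _ _ _ _ _ _ (fun s1 => [/\ env_ready f c s1,
  imem s1 3 0 = 0 & rmem s1 6 0 = rmem s 6 0])); first exact: halts_run.
move=> s1 [ready1 s13 <-].
apply: (@halts_seq _ _ _ _ _ _ (fun s2 => [/\ env_ready f c s2,
  imem s2 3 0 = 0, imem s2 18 0 = 0 & rmem s2 6 0 = rmem s1 6 0])); first exact: halts_run.
move=> s2 [ready2 s23 s218 <-].
apply: halts_seq.
  apply: halts_frame.
  apply: (@halts_while R _ _ (env_inv flip f c) env_potential 300 (2 * n)).
  - move=> s3 _ inv3 /=; have [[[n3 _ _ _] _] _] := inv3.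
    rewrite n3 addn1 => lt_n.
    apply: halts_run_le; [by case: (flip)|exact: envelope_step_cost|].
    exact: envelope_step_run.
  - split=> //; exists 0, 1; split => //; rewrite s218.
    by apply: stack_inv_empty => a [].
  - by rewrite /env_potential s23 s218 subn0 addn0.
move=> s3 [[[[[n3 o3 f3 c3] [x3 v3]] [i [e [i3 lein inv]]]] /=]].
rewrite n3 i3 addn1 -leqNgt => lt_ni [_ r_eq].
have iE : i = n by apply/eqP; rewrite eqn_leq lein.
have candN : candidate f c i = None by rewrite /candidate iE ltnn.
rewrite {}candN iE in inv.
have <- : rmem s3 6 0 = rmem s2 6 0 by rewrite r_eq //; case: (flip).
have procP a : processed f c n a <-> (a < n)%N /\ f a = c.
  split=> [[i' lt [<- fa]]|[/ord_surj[i' lt <-] fa]]; last by exists i'.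
  by split=> //; exact: ord_lt.
have cost : (max_cost (If (BILe (IConst 1) (IVar 18))
       (RSet 6 (IConst 0) (RAdd (RVar 6)
          (RAdd (RGet 5 below_top)
             (segment_exp flip (IGet 19 below_top) (RGet 4 below_top) (RConst 1)))))
       Skip) <= 100)%N by case: (flip).
apply: (halts_run_le _ cost) => //.
rewrite run_if; case s18 : (imem s3 18 0) => [|m].
  rewrite /= s18 M0 ?addr0 // => a lt_a fa.
  (* An empty stack at the end means an empty cluster: without a candidate [e = 1], which rules out
     [e = 0]. *)
  rewrite s18 in inv; have [_ /(_ erefl)[e0|A0] _ _ [_ h6]] := inv; last first.
    by apply: (A0 a); apply/procP.
  case: h6 => [e1|[l []//]].
  by move: (@oner_eq0 R); rewrite -e1 e0 eqxx.
have -> : beval s3 (BILe (IConst 1) (IVar 18)) by rewrite /= s18.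
rewrite s18 in inv.
rewrite (stack_integral inv cM); last 2 first.
- by move=> t t01 a /procP[]; exact: Mge.
- move=> t t01; have [_ _ _ /(_ m (ltnSn m))[/procP[lt_m fm] _ _] _] := inv.
  by have [a [lt_a fa ME]] := Mex t t01 _ lt_m fm; exists a => //; apply/procP.
have -> : run (RSet 6 (IConst 0) (RAdd (RVar 6)
          (RAdd (RGet 5 below_top)
             (segment_exp flip (IGet 19 below_top) (RGet 4 below_top) (RConst 1))))) s3 =
  Store (imem s3) (update (rmem s3) 6 0 (reval s3 (RVar 6) + (reval s3 (RGet 5 below_top) +
     reval s3 (segment_exp flip (IGet 19 below_top) (RGet 4 below_top) (RConst 1))))).
  by [].
by rewrite reval_segment //= /update /= s18 subn1.
Qed.

End EnvelopeProgram.

(** * Evaluating a sequence of cuts *)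

Definition n_exp := IGet 0 (IConst 0).
Definition k_exp := IGet 0 (IConst 1).
Definition k1_exp := ISub k_exp (IConst 1).

Definition cost_cmd : cmd :=
  Seq (RSet 6 (IConst 0) (RConst 0))
    (For 16 k_exp (Seq (envelope_cmd false) (envelope_cmd true))).

Definition place_in a t := RAdd (RGet 0 a) (RMul (RGet 1 a) t).

Definition relabel_cmd : cmd :=
  If (BAnd (IEq (IGet 13 (IVar 15)) (IGet 12 (IVar 14)))
       (BAnd (BRLe (RVar 3) (place_in (IVar 15) (RVar 2)))
         (BNot (BAnd (BRLe (place_in (IVar 15) (RVar 2)) (RVar 3))
                 (BNot (BRLe (RGet 1 (IVar 8)) (RGet 1 (IVar 15))))))))
    (ISet 13 (IVar 15) (IAdd (IVar 14) (IConst 1))) Skip.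

Definition level_cmd : cmd :=
  Seq (ISet 8 (IConst 0) (IGet 6 (IGet 12 (IAdd k1_exp (IVar 14)))))
  (Seq (ISet 9 (IConst 0) (IGet 7 (IGet 12 (IAdd k1_exp (IVar 14)))))
  (Seq (RSet 2 (IConst 0)
     (RDiv (RSub (RGet 0 (IVar 9)) (RGet 0 (IVar 8)))
           (RSub (RGet 1 (IVar 8)) (RGet 1 (IVar 9)))))
  (Seq (RSet 3 (IConst 0) (place_in (IVar 8) (RVar 2)))
    (For 15 n_exp relabel_cmd)))).

Definition labels_cmd : cmd :=
  Seq (For 15 n_exp (ISet 13 (IVar 15) (IConst 0)))
      (For 14 k1_exp level_cmd).

Section LeafProgram.
Variables (R : realType) (n k : nat) (S : 'I_n -> trajectory R).
Variables (xs vs : nat -> R) (ord : nat -> nat).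
Import numFieldNormedType.Exports.
Local Notation mu := (@lebesgue_measure R).

Hypothesis SE : forall i : 'I_n, S i = (xs i, vs i).
Hypothesis ord_lt : forall i, (i < n)%N -> (ord i < n)%N.
Hypothesis ord_surj : forall l, (l < n)%N -> exists2 i, (i < n)%N & ord i = l.
Hypothesis ord_mono : forall i j, (i <= j)%N -> (j < n)%N -> vs (ord i) <= vs (ord j).

(** The second integrand is the upper envelope of the flipped trajectories; reversing time does not
    change its integral. *)
Lemma diam_envelopes (D : {set 'I_n}) :
  \int[mu]_(t in `[0, 1]%classic) upper S D t +
  \int[mu]_(t in `[0, 1]%classic) - lower S D (1 - t) = diam S D.
Proof.
have cl : continuous (fun t : R => - lower S D t).
  by move=> t; apply: continuousN; exact: continuous_lower.
rewrite (integral_reverse cl) diamE -RintegralD //.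
- by apply: integrable_continuous; exact: continuous_upper.
- by apply: integrable_continuous.
Qed.

Definition leaf_ready (s : store R) : Prop :=
  [/\ imem s 0 0 = n, imem s 0 1 = k & imem s 2 = ord] /\
  (rmem s 0 = xs /\ rmem s 1 = vs).

Lemma cost_halts s : leaf_ready s ->
  halts cost_cmd (3000 * k.+1 * n.+1) s
    (fun s' => rmem s' 6 0 = sd S (@clusters n k (imem s 13))).
Proof.
move=> [[n0 k0 o0] [x0 v0]].
pose f := imem s 13; pose D (c : nat) := [set i : 'I_n | f i == c]%SET.
pose T := (700 * n.+1 + 700 * n.+1)%N.
apply: (@halts_weaken _ _ _ (3 + (k * (T + 2 + 13) + 2 + 9))) => //; last 2 first.
- by rewrite /T; nia.
- by move=> s'; exact.
apply: (@halts_seq _ _ _ _ _ _ (fun s1 => [/\ leaf_ready s1, imem s1 13 = f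
  & rmem s1 6 0 = 0])); first exact: halts_run.
move=> {n0 k0 o0 x0 v0} s1 [[[n1 k1 o1] [x1 v1]] f1 r1].
pose I c (s' : store R) := rmem s' 6 0 = \sum_(0 <= j < c) diam S (D j).
apply: (@halts_weaken _ _ _ (k * (T + icost k_exp + 13) + icost k_exp + 9) _ (I k)) => //;
  last by move=> s' ->; rewrite big_mkord.
apply: halts_for => //.
- by move=> s' [iu _]; rewrite /= iu.
- move=> c s2 ck [iu ru] c2 I2.
  have ready2 : env_ready xs vs n ord f c s2.
    by rewrite /env_ready iu ?ru // (iu 2) // (iu 13).
  have cont_rev : continuous (fun t : R => - lower S (D c) (1 - t)).
    move=> t; apply: cvgN.
    apply: (@continuous_comp _ _ _ (fun t : R => 1 - t) (lower S (D c))).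
      by apply: cvgB; [exact: cvg_cst|exact: cvg_id].
    exact: continuous_lower.
  apply: (@halts_seq _ _ _ _ _ _ (fun s3 => env_ready xs vs n ord f c s3 /\
    rmem s3 6 0 = \sum_(0 <= j < c) diam S (D j) +
      \int[mu]_(t in `[0, 1]%classic) upper S (D c) t)).
    apply: halts_weaken (halts_frame
      (envelope_halts ord_lt ord_surj ord_mono (flip := false) ready2 (M := upper S (D c)) _ _ _ _))
      (leqnn _) _.
    + exact: continuous_upper.
    + move=> t t01 a lt_a fa; have := @upper_ge R n S (D c) t (Ordinal lt_a).
      by rewrite inE /= fa eqxx => /(_ isT); rewrite SE.
    + move=> t t01 a lt_a fa.
      have [|j] := @upper_mem R n S (D c) t (Ordinal lt_a); first by rewrite inE /= fa.
      rewrite inE => /eqP fj ->; exists j; split => //.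
      by rewrite SE.
    + move=> Dc0; rewrite (_ : D c = finset.set0); last first.
        by apply/setP => i; rewrite !inE; apply/eqP; exact: Dc0.
      rewrite (@eq_Rintegral _ _ _ _ _ (fun=> 0)) ?Rintegral_cst ?mul0r //.
      by move=> t _; rewrite /upper; case: pickP => // i; rewrite inE.
    move=> s3 [r3 [iu3 ru3]]; rewrite r3 I2; split => //.
    by move: ready2; rewrite /env_ready !iu3 ?ru3.
  move=> s3 [ready3 r3].
  apply: halts_weaken
      (envelope_halts ord_lt ord_surj ord_mono (flip := true) ready3
        (M := fun t => - lower S (D c) (1 - t)) cont_rev _ _ _)
      (leqnn _) _.
  + move=> t t01 a lt_a fa; have := @lower_le R n S (D c) (1 - t) (Ordinal lt_a).
    rewrite inE /= fa eqxx => /(_ isT); rewrite SE /place /position /=.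
    by move=> h; lra.
  + move=> t t01 a lt_a fa.
    have [|j] := @lower_mem R n S (D c) (1 - t) (Ordinal lt_a); first by rewrite inE /= fa.
    rewrite inE => /eqP fj ->; exists j; split => //.
    by rewrite SE /place /position /=; ring.
  + move=> Dc0; rewrite (_ : D c = finset.set0); last first.
      by apply/setP => i; rewrite !inE; apply/eqP; exact: Dc0.
    rewrite (@eq_Rintegral _ _ _ _ _ (fun=> 0)) ?Rintegral_cst ?mul0r //.
    by move=> t _; rewrite /lower; case: pickP => [i|_]; rewrite ?inE ?oppr0.
  move=> s4 r4; rewrite /I /= r4 r3 -addrA diam_envelopes.
  by rewrite big_nat_recr.
- by rewrite /I /= r1 big_nil.
Qed.

Variables (D A B : nat -> nat).

Lemma labels_halts s : leaf_ready s ->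
  imem s 12 = D -> imem s 6 = A -> imem s 7 = B ->
  halts labels_cmd (300 * k.+1 * n.+1) s
    (fun s' => forall l, (l < n)%N -> imem s' 13 l =
       label xs vs D (fun j => A (D (k.-1 + j))) (fun j => B (D (k.-1 + j))) k.-1 l).
Proof.
move=> [[n0 k0 o0] [x0 v0]] D0 A0 B0.
pose T := (n * (100 + 2 + 13) + 2 + 9)%N.
apply: (@halts_weaken _ _ _ ((n * (100 + 2 + 13) + 2 + 9) + (k.-1 * (100 + T + 4 + 13) + 4 + 9)))
  => //; last 2 first.
- by rewrite /T; nia.
- by move=> s'; exact.
set a := fun j => A _; set b := fun j => B _.
pose I0 i (s' : store R) := forall l, (l < i)%N -> imem s' 13 l = 0.
apply: (@halts_seq _ _ _ _ _ _ (fun s1 => I0 n s1 /\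
   unchanged (For 15 n_exp (ISet 13 (IVar 15) (IConst 0))) s s1)).
  apply: halts_frame; apply: (@halts_for _ 15 n_exp _ I0) => //.
    by move=> s' [iu _]; rewrite /= iu.
  move=> i s' lt_in _ i15 Ii; apply: halts_run_le => // l /=.
  rewrite ltnS leq_eqVlt /update /= i15 => /predU1P[->|li]; first by rewrite eqxx.
  by rewrite (ltn_eqF li); exact: Ii.
move=> s1 [f1 [iu1 ru1]].
pose I j (s' : store R) := forall l, (l < n)%N -> imem s' 13 l = label xs vs D a b j l.
apply: (@halts_for _ 14 k1_exp _ I) => //.
  by move=> s' [iu _]; rewrite /= iu // iu1 // k0 subn1.
move=> j s2 lt_jk [iu2 ru2] j2 I2.
have k2 : imem s2 0 1 = k by rewrite iu2 // iu1.
have D2 : imem s2 12 = D by rewrite iu2 // iu1.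
have A2 : imem s2 6 = A by rewrite iu2 // iu1.
have B2 : imem s2 7 = B by rewrite iu2 // iu1.
have x2 : rmem s2 0 = xs by rewrite ru2 // ru1.
have v2 : rmem s2 1 = vs by rewrite ru2 // ru1.
have n2 : imem s2 0 0 = n by rewrite iu2 // iu1.
apply: (@halts_weaken _ _ _ (11 + (11 + (17 + (12 + (n * (100 + 2 + 13) + 2 + 9))))) _
  (fun s' => forall l, (l < n)%N -> imem s' 13 l = label xs vs D a b j.+1 l)).
- do 4 (apply: halts_seq_run => //).
  set s3 := run _ _.
  have [n3 a3 b3 j3] : [/\ imem s3 0 0 = n, imem s3 8 0 = a j, imem s3 9 0 = b j &
      imem s3 14 0 = j].
    by split; rewrite /s3 //= /update /= ?D2 ?A2 ?B2 ?k2 ?j2 ?subn1.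
  have D3 : imem s3 12 = D by rewrite -D2.
  have [x3 v3] : rmem s3 0 = xs /\ rmem s3 1 = vs by rewrite -x2 -v2.
  have t3 : rmem s3 2 0 = cut_time xs vs (a j) (b j).
    by rewrite -x3 -v3 -a3 -b3.
  have y3 : rmem s3 3 0 = place xs vs (a j) (cut_time xs vs (a j) (b j)).
    by rewrite -t3 -x3 -v3 -a3.
  have f3 l : (l < n)%N -> imem s3 13 l = label xs vs D a b j l by exact: I2.
  move: s3 n3 a3 b3 j3 D3 x3 v3 t3 y3 f3 => s3 n3 a3 b3 j3 D3 x3 v3 t3 y3 f3.
  (* Relabelling works in place, since the new label of a trajectory depends on no label but its
     own. *)
  pose J i (s' : store R) := forall l, (l < n)%N -> imem s' 13 l =
    label xs vs D a b (if (l < i)%N then j.+1 else j) l.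
  apply: (@halts_weaken _ _ _ (n * (100 + 2 + 13) + 2 + 9) _ (J n)) => //.
    apply: (@halts_for _ 15 n_exp _ J) => //.
      by move=> s' [iu _]; rewrite /= iu.
    move=> i s4 lt_in [iu4 ru4] i4 J4; apply: halts_run_le => // l lt_ln.
    rewrite /relabel_cmd run_if.
    have -> : beval s4 (BAnd (IEq (IGet 13 (IVar 15)) (IGet 12 (IVar 14)))
       (BAnd (BRLe (RVar 3) (place_in (IVar 15) (RVar 2)))
         (BNot (BAnd (BRLe (place_in (IVar 15) (RVar 2)) (RVar 3))
                 (BNot (BRLe (RGet 1 (IVar 8)) (RGet 1 (IVar 15)))))))) =
      (label xs vs D a b j i == D j) && above xs vs (a j) (b j) i.
      rewrite /= -eqn_leq i4 J4 // ltnn !iu4 // D3 j3 a3 !ru4 // x3 v3 t3 y3.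
      by [].
    case: ifP => [cond|cond]; rewrite /= /update /=.
      rewrite i4 iu4 // j3 addn1; have [->|li] := eqVneq l i.
        by rewrite ltnSn /= cond.
      by rewrite J4 // ltnS [(l <= i)%N]leq_eqVlt (negbTE li).
    rewrite J4 // ltnS [(l <= i)%N]leq_eqVlt; have [->|li] := eqVneq l i => //.
    by rewrite ltnn /= cond.
  by move=> s' J' l lt_ln; rewrite J' // lt_ln.
- by rewrite /T; lia.
- by move=> s' I' l lt_ln; rewrite /= /update /= I'.
Qed.

End LeafProgram.

(** * The odometer *)

Section Odometer.
Variable B : nat -> nat.
Implicit Types d : nat -> nat.

(** Mixed-radix numeration, lowest digit first. *)
Definition weight m : nat := (\prod_(i < m) B i)%N.
Definition value m d : nat := (\sum_(i < m) d i * weight i)%N.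
Definition valid_digits m d : Prop := forall i, (i < m)%N -> (d i < B i)%N.

Lemma weightS m : weight m.+1 = (weight m * B m)%N.
Proof. by rewrite /weight big_ord_recr. Qed.

Lemma valueS m d : value m.+1 d = (value m d + d m * weight m)%N.
Proof. by rewrite /value big_ord_recr. Qed.

Lemma value_lt m d : valid_digits m d -> (value m d < weight m)%N.
Proof.
elim: m => [|m IH] vd; first by rewrite /value /weight !big_ord0.
have /IH lt_m : valid_digits m d by move=> i im; apply: vd; exact: ltnW.
rewrite valueS weightS; have := vd m (ltnSn m); nia.
Qed.

(** The search measures progress by [value] alone; injectivity identifies the digits with the
    current value as those just evaluated. *)
Lemma value_inj m d d' : valid_digits m d -> valid_digits m d' ->
  value m d = value m d' -> forall i, (i < m)%N -> d i = d' i.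
Proof.
elim: m => [//|m IH] vd vd'; rewrite !valueS.
have vdm : valid_digits m d by move=> i im; apply: vd; exact: ltnW.
have vdm' : valid_digits m d' by move=> i im; apply: vd'; exact: ltnW.
have := value_lt vdm; have := value_lt vdm'.
move: (value m d) (value m d') (IH vdm vdm') => u u' {}IH lu lu' e.
have dm : d m = d' m by nia.
move=> i; rewrite ltnS leq_eqVlt => /predU1P[->//|]; apply: IH.
by move: e; rewrite dm; lia.
Qed.

Lemma value_full m d : (forall i, (i < m)%N -> d i + 1 = B i)%N ->
  (value m d + 1 = weight m)%N.
Proof.
elim: m => [|m IH] full; first by rewrite /value /weight !big_ord0.
rewrite valueS weightS -(full m (ltnSn m)) -IH; first by ring.
by move=> i im; apply: full; exact: ltnW.
Qed.

Lemma value_next m p d d' : (p < m)%N ->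
  (forall i, (i < p)%N -> d i + 1 = B i /\ d' i = 0)%N ->
  d' p = (d p + 1)%N -> (forall i, (p < i)%N -> d' i = d i) ->
  value m d' = (value m d + 1)%N.
Proof.
move=> pm low d'p high; elim: m pm => // m IH; rewrite ltnS leq_eqVlt => /predU1P[<-|pm].
  rewrite !valueS d'p -(@value_full p d) => [|i ip]; last by case: (low i ip).
  have -> : value p d' = 0.
    by apply: big1 => i _; case: (low i (ltn_ord i)) => _ ->.
  by ring.
by rewrite !valueS IH // high //; ring.
Qed.

Lemma value0 m : value m (fun=> 0) = 0.
Proof. by apply: big1 => i _; rewrite mul0n. Qed.

End Odometer.

Definition digits_exp := IAdd k1_exp k1_exp.

Definition next_cmd : cmd :=
  Seq (ISet 22 (IConst 0) (IConst 0))
  (Seq (While (BAnd (ILt (IVar 22) digits_exp)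
               (BILe (IGet 11 (IVar 22)) (IAdd (IGet 12 (IVar 22)) (IConst 1))))
          (Seq (ISet 12 (IVar 22) (IConst 0)) (IInc 22)))
    (If (ILt (IVar 22) digits_exp)
       (ISet 12 (IVar 22) (IAdd (IGet 12 (IVar 22)) (IConst 1)))
       (ISet 20 (IConst 0) (IConst 0)))).

(** The carry stops at the first digit that is not full. If there is none, [d] was the last vector
    and flag 20 is cleared. *)
Lemma next_halts (R : realType) k B d (s : store R) :
  imem s 0 1 = k -> imem s 11 = B -> imem s 12 = d ->
  valid_digits B (k.-1 + k.-1) d ->
  halts next_cmd (200 * k.+1) s (fun s' =>
    [/\ valid_digits B (k.-1 + k.-1) (imem s' 12),
        value B (k.-1 + k.-1) (imem s' 12) = (value B (k.-1 + k.-1) d + 1)%N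
      & imem s' 20 0 = imem s 20 0] \/
    imem s' 20 0 = 0 /\ weight B (k.-1 + k.-1) = (value B (k.-1 + k.-1) d + 1)%N).
Proof.
set m := (k.-1 + k.-1)%N => k0 B0 d0 vd.
apply: (@halts_weaken _ _ _ (3 + ((m * (10 + 25) + 25) + 100))) => //; last 2 first.
- by rewrite /m; lia.
- by move=> s'; exact.
apply: halts_seq_run => //; set s1 := run _ _.
have [k1 B1 d1] : [/\ imem s1 0 1 = k, imem s1 11 = B & imem s1 12 = d] by [].
have p1 : imem s1 22 0 = 0 by [].
have <- : imem s1 20 0 = imem s 20 0 by [].
move: s1 k1 B1 d1 p1 => s1 k1 B1 d1 p1.
pose J (s' : store R) := exists p, [/\ imem s' 22 0 = p, (p <= m)%N,
  forall i, (i < p)%N -> (d i + 1 = B i)%N /\ imem s' 12 i = 0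
  & forall i, (p <= i)%N -> imem s' 12 i = d i].
apply: halts_seq.
  apply: halts_frame.
  apply: (@halts_while R _ _ J (fun s' => m - imem s' 22 0)%N _ m) => //.
  - move=> s2 [iu ru] [p [p2 pm low high]] /=.
    rewrite (iu 0) // (iu 11) // p2 k1 B1 subn1 -/m addn1 high // => /andP[lt_pm full].
    apply: halts_run_le => //; rewrite /J /= /update /= p2 addn1.
    split; last by lia.
    exists p.+1; split => // i.
    + rewrite ltnS leq_eqVlt => /predU1P[->|ip].
        by rewrite eqxx; split => //; have := vd p lt_pm; lia.
      by rewrite (ltn_eqF ip); exact: low.
    + by move=> pi; rewrite (gtn_eqF pi); apply: high; exact: ltnW.
  - by exists 0; split => // i _; rewrite d1.
  - by rewrite leq_subr.
move=> s2 [[[p [p2 pm low high]] /=]] cond [iu ru].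
apply: halts_run_le => //=.
move: cond; rewrite (iu 0) // (iu 11) // p2 k1 B1 subn1 -/m addn1 high //.
case: ifP => [lt_pm /= notfull|/negbT le_mp _]; rewrite /= /update /= ?p2.
- left; split => //.
  + move=> i im; case: eqP => [->|/eqP ip]; first by lia.
    have [lt_ip|le_pi] := ltnP i p; last by rewrite high ?vd.
    by case: (low i lt_ip) => _ ->; exact: leq_ltn_trans (vd i im).
  + apply: (@value_next _ _ p) => //.
    * move=> i ip; rewrite (ltn_eqF ip); exact: low.
    * by rewrite eqxx.
    * by move=> i pi; rewrite (gtn_eqF pi) high // ltnW.
  + by rewrite iu.
- right; split => //; have mp : m = p by lia.
  by rewrite (@value_full B m d) // mp => i /low [].
Qed.

(** * Sorting and tabulating the cuts *)

Section Ranks.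
Variables (R : realType) (n : nat) (v : nat -> R).

(** Equal velocities are ordered by index, which makes this a strict total order and the ranks
    distinct. *)
Definition before j i : bool := (v j <= v i) && ~~ ((v i <= v j) && (i <= j)%N).

Definition rank i : nat := (\sum_(0 <= j < n) before j i)%N.

Lemma before_irr i : before i i = false.
Proof. by rewrite /before lexx leqnn. Qed.

Lemma before_trans : transitive before.
Proof.
move=> j i l /andP[ij nij] /andP[jl njl]; rewrite /before (le_trans ij jl) /=.
apply/negP => /andP[li il].
have lj := le_trans li ij; have ji := le_trans jl li.
by move: nij njl; rewrite lj ji /= -!ltnNge => h1 h2; lia.
Qed.

Lemma before_total i j : i != j -> before i j || before j i.
Proof.
move=> ij; rewrite /before; have [h|h|h] := ltgtP (v i) (v j) => //=.
by rewrite -!ltnNge; move: ij; rewrite neq_ltn.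
Qed.

Lemma before_rank i j : (i < n)%N -> before i j -> (rank i < rank j)%N.
Proof.
move=> lt_in ij; rewrite /rank !big_mkord (bigD1 (Ordinal lt_in)) //=.
rewrite [ltnRHS](bigD1 (Ordinal lt_in)) //= before_irr ij add0n add1n ltnS.
apply: leq_sum => l _; case lj : (before l j); first by case: (before l i).
case li : (before l i) => //.
by rewrite (before_trans li ij) in lj.
Qed.

Lemma rank_lt i : (i < n)%N -> (rank i < n)%N.
Proof.
move=> lt_in; rewrite /rank big_mkord (bigD1 (Ordinal lt_in)) //= before_irr add0n.
have nE : n = (\sum_(j < n) 1)%N by rewrite sum1_card card_ord.
rewrite [ltnRHS]nE [ltnRHS](bigD1 (Ordinal lt_in)) //= add1n ltnS.
by apply: leq_sum => l _; case: before.
Qed.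

Lemma rank_surj l : (l < n)%N -> exists2 i, (i < n)%N & rank i = l.
Proof.
move=> lt_ln; pose r (i : 'I_n) := Ordinal (rank_lt (ltn_ord i)).
have r_inj : injective r.
  move=> i j /(congr1 val) /= e; apply/eqP/negPn/negP => ij.
  have /orP[/before_rank|/before_rank] := before_total ij.
    by rewrite e ltnn => /(_ (ltn_ord i)).
  by rewrite e ltnn => /(_ (ltn_ord j)).
have [r' _ rK] := injF_bij r_inj.
exists (r' (Ordinal lt_ln)) => //.
by have /(congr1 val) := rK (Ordinal lt_ln).
Qed.

Definition sorts_by_velocity (ord : nat -> nat) : Prop :=
  [/\ forall i, (i < n)%N -> (ord i < n)%N,
      forall l, (l < n)%N -> exists2 i, (i < n)%N & ord i = l
    & forall i j, (i <= j)%N -> (j < n)%N -> v (ord i) <= v (ord j)].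

Lemma rank_sorts (ord : nat -> nat) :
  (forall i, (i < n)%N -> ord (rank i) = i) -> sorts_by_velocity ord.
Proof.
move=> ordE; split.
- by move=> l /rank_surj[i lt_in <-]; rewrite ordE.
- by move=> l lt_ln; exists (rank l); [exact: rank_lt|exact: ordE].
- move=> l l' le_ll' lt_l'n.
  have [i' lt_i'n ri'] := rank_surj lt_l'n.
  have [i lt_in ri] := rank_surj (leq_ltn_trans le_ll' lt_l'n).
  rewrite -ri -ri' !ordE // leNgt; apply/negP => lt_v.
  have /(before_rank lt_i'n) : before i' i by rewrite /before (ltW lt_v) leNgt lt_v.
  by rewrite ri ri' ltnNge le_ll'.
Qed.

End Ranks.

Definition before_exp j i :=
  BAnd (BRLe (RGet 1 j) (RGet 1 i))
    (BNot (BAnd (BRLe (RGet 1 i) (RGet 1 j)) (BILe i j))).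

(** Sorting by counting predecessors is quadratic, which the cubic or larger bound for k at least 2
    can afford. *)
Definition sort_cmd : cmd :=
  For 3 n_exp
    (Seq (ISet 5 (IConst 0) (IConst 0))
    (Seq (For 4 n_exp (If (before_exp (IVar 4) (IVar 3)) (IInc 5) Skip))
      (ISet 2 (IVar 5) (IVar 3)))).

Lemma sort_halts (R : realType) n (s : store R) :
  imem s 0 0 = n ->
  halts sort_cmd (100 * n.+1 * n.+1) s
    (fun s' => sorts_by_velocity n (rmem s 1) (imem s' 2)).
Proof.
move=> n0; set v := rmem s 1.
pose T := (n * (40 + 2 + 13) + 2 + 9)%N.
pose J i (s' : store R) := forall i', (i' < i)%N -> imem s' 2 (rank n v i') = i'.
apply: (@halts_weaken _ _ _ (n * ((3 + (T + 5)) + 2 + 13) + 2 + 9) _ (J n)).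
- apply: (@halts_for _ 3 n_exp _ J) => //.
    by move=> s' [iu _]; rewrite /= iu.
  move=> i s1 lt_in [iu ru] i1 J1.
  apply: halts_seq_run => //; set s2 := run _ _.
  have [n2 i2 c2 J2] : [/\ imem s2 0 0 = n, imem s2 3 0 = i, imem s2 5 0 = 0 & J i s2].
    by split => //=; rewrite /update /= iu.
  have v2 : rmem s2 1 = v by rewrite /= ru.
  move: s2 n2 i2 c2 J2 v2 => s2 n2 i2 c2 J2 v2.
  pose K j (s' : store R) := imem s' 5 0 = (\sum_(0 <= l < j) before v l i)%N.
  apply: (@halts_seq _ _ _ _ _ _ (fun s3 => K n s3 /\ imem s3 3 0 = i /\ J i s3)).
    apply: halts_weaken (halts_frame (@halts_for _ 4 n_exp _ K n 40 s2 _ _ _ _)) (leqnn _) _ => //.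
    + by move=> s' [iu' _]; rewrite /= iu'.
    + move=> j s3 lt_jn [iu3 ru3] j3 K3; apply: halts_run_le => //.
      rewrite run_if.
      have -> : beval s3 (before_exp (IVar 4) (IVar 3)) = before v j i.
        by rewrite /= j3 iu3 // i2 ru3 // v2.
      rewrite /K big_nat_recr //= -K3.
      by case: ifP => _; rewrite /= /update /= ?addn0.
    + by rewrite /K big_nil.
    + by move=> s3 [K3 [iu3 ru3]]; rewrite /J !iu3.
  move=> s3 [K3 [i3 J3]]; apply: halts_run_le => //.
  move=> i'; rewrite ltnS leq_eqVlt /= /update /= K3 i3 -/(rank n v i).
  have [->|ii'] /= := eqVneq i' i; first by rewrite eqxx.
  (* Distinct trajectories have distinct ranks, so no cell filled earlier is overwritten. *)
  move=> lt_i'; case: eqP => [e|_]; last exact: J3.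
  have /orP[/before_rank|/before_rank] := before_total v ii'.
    by move=> /(_ n (ltn_trans lt_i' lt_in)); rewrite e ltnn.
  by move=> /(_ n lt_in); rewrite e ltnn.
- by rewrite /T; nia.
- by move=> s' J'; exact: rank_sorts.
Qed.

(** The triangle of positions [b <= a] is listed row by row. Counter 10 ends at n (n + 1) / 2,
    obtained by counting as integers have no multiplication. *)
Definition pairs_cmd : cmd :=
  While (ILt (IVar 8) n_exp)
    (Seq (ISet 6 (IVar 10) (IGet 2 (IVar 8)))
    (Seq (ISet 7 (IVar 10) (IGet 2 (IVar 9)))
    (Seq (IInc 10)
      (If (BILe (IVar 8) (IVar 9))
        (Seq (IInc 8) (ISet 9 (IConst 0) (IConst 0)))
        (IInc 9))))).

Lemma pairs_halts (R : realType) n (s : store R) :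
  imem s 0 0 = n -> imem s 8 0 = 0 -> imem s 9 0 = 0 -> imem s 10 0 = 0 ->
  halts pairs_cmd (100 * n.+1 * n.+1) s (fun s' =>
    (2 * imem s' 10 0 = n * n.+1)%N /\
    forall a b, (b <= a)%N -> (a < n)%N -> exists2 q, (q < imem s' 10 0)%N &
      imem s' 6 q = imem s 2 a /\ imem s' 7 q = imem s 2 b).
Proof.
move=> n0 a0 b0 q0.
pose J (s' : store R) := exists a b q,
  [/\ [/\ imem s' 8 0 = a, imem s' 9 0 = b & imem s' 10 0 = q],
      (b <= a)%N && (a <= n)%N, (a = n -> b = 0), (2 * q = a * a.+1 + 2 * b)%N
    & forall a' b', (b' <= a')%N -> (a' < a)%N || (a' == a) && (b' < b)%N ->
        exists2 q', (q' < q)%N & imem s' 6 q' = imem s 2 a' /\ imem s' 7 q' = imem s 2 b'].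
rewrite /pairs_cmd; set body := Seq _ _.
apply: (@halts_weaken _ _ _ (n * n.+1 * (45 + 8) + 8) _ _ _
  (halts_frame (@halts_while R (ILt (IVar 8) n_exp) body J (fun s' => n * n.+1 - 2 * imem s' 10 0)%N 45
     (n * n.+1) s _ _ _))).
- move=> s1 [iu ru] [a [b [q [[a1 b1 q1] /andP[ba an] bn qE tab]]]] /=.
  rewrite (iu 0) // n0 a1 addn1 => lt_an.
  have ord1 : imem s1 2 = imem s 2 by exact: iu.
  have tabS a' b' : (b' <= a')%N ->
      (a' < a)%N || (a' == a) && (b' < b.+1)%N ->
      exists2 q', (q' < q.+1)%N &
        (if q' == q then imem s 2 a else imem s1 6 q') = imem s 2 a' /\
        (if q' == q then imem s 2 b else imem s1 7 q') = imem s 2 b'.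
    move=> ba'; rewrite ltnS [(b' <= b)%N]leq_eqVlt andb_orr orbCA.
    case/orP => [/andP[/eqP -> /eqP ->]|/(tab _ _ ba')[q' lt_q e]].
      by exists q; rewrite ?eqxx.
    by exists q'; [exact: leqW|rewrite (ltn_eqF lt_q)].
  apply: halts_run_le => //=; rewrite /J /update /= a1 b1 q1 !addn1 ord1.
  have [le_ab|lt_ba] := leqP a b; rewrite /=.
    have abE : b = a by lia.
    split; last by nia.
    exists a.+1, 0, q.+1; split => //; first by lia.
    move=> a' b' ba' lt_ab'; apply: tabS => //.
    move: lt_ab'; rewrite ltn0 andbF orbF ltnS leq_eqVlt.
    by case/predU1P => [aa|->//]; apply/orP; right; rewrite aa eqxx /=; lia.
  split; last by nia.
  exists a, b.+1, q.+1; split => //; [by lia|by lia|by lia].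
- exists 0, 0, 0; split => //= a' b' ba'.
  by rewrite !ltn0 andbF.
- by rewrite leq_subr.
- by nia.
- move=> s1 [[[a [b [q [[a1 b1 q1] /andP[ba an] bn qE tab]]]] /=]] + [iu _].
  rewrite (iu 0) // n0 a1 addn1 -leqNgt => le_na.
  have aE : a = n by lia.
  rewrite q1; split; first by rewrite qE (bn aE) aE; lia.
  by move=> a' b' ba' lt_a'; apply: tab => //; rewrite aE lt_a'.
Qed.

(** Digit [j] selects one of the [j.+1] parts present at step [j], digit [k.-1 + j] one of the
    tabulated pairs. *)
Definition bounds_cmd : cmd :=
  For 4 k1_exp
    (Seq (ISet 11 (IVar 4) (IAdd (IVar 4) (IConst 1)))
         (ISet 11 (IAdd k1_exp (IVar 4)) (IVar 10))).

Lemma bounds_halts (R : realType) k (s : store R) :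
  imem s 0 1 = k ->
  halts bounds_cmd (100 * k.+1) s (fun s' => forall j, (j < k.-1)%N ->
    imem s' 11 j = j.+1 /\ imem s' 11 (k.-1 + j)%N = imem s 10 0).
Proof.
move=> k0.
pose J i (s' : store R) := forall j, (j < i)%N ->
  imem s' 11 j = j.+1 /\ imem s' 11 (k.-1 + j)%N = imem s 10 0.
apply: (@halts_weaken _ _ _ (k.-1 * (40 + 4 + 13) + 4 + 9) _ (J k.-1)) => //; last by lia.
apply: (@halts_for _ 4 k1_exp _ J) => //.
  by move=> s' [iu _]; rewrite /= iu // k0 subn1.
move=> i s1 lt_ik [iu _] i1 J1; apply: halts_run_le => //.
rewrite /J /= /update /= i1 (iu 0) // (iu 10) // k0 subn1 addn1 => j.
rewrite ltnS leq_eqVlt eqn_add2l => /predU1P[->|lt_ji].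
  by rewrite !eqxx; case: eqP => // e; lia.
have [-> ->] := J1 j lt_ji; rewrite (ltn_eqF lt_ji).
by do 2 (case: eqP => [e|_]; first lia).
Qed.

(** * The search *)

(** Flag 21 equal to 0 plays the role of an infinite best cost. *)
Definition keep_best_cmd : cmd :=
  If (BNot (BAnd (BILe (IConst 1) (IVar 21)) (BRLe (RVar 7) (RVar 6))))
    (Seq (RSet 7 (IConst 0) (RVar 6))
    (Seq (ISet 21 (IConst 0) (IConst 1))
      (For 15 n_exp (ISet 1 (IVar 15) (IGet 13 (IVar 15))))))
    Skip.

Definition leaf_cmd : cmd :=
  Seq labels_cmd (Seq cost_cmd (Seq keep_best_cmd next_cmd)).

Definition search_cmd : cmd :=
  Seq (ISet 20 (IConst 0) (IConst 1))
      (While (BILe (IConst 1) (IVar 20)) leaf_cmd).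

Definition clustering_cmd : cmd :=
  If (BILe k_exp (IConst 1)) Skip
    (Seq sort_cmd (Seq pairs_cmd (Seq bounds_cmd search_cmd))).

Section Search.
Variables (R : realType) (n k : nat) (S : 'I_n -> trajectory R).
Variables (xs vs : nat -> R) (ord A B bound : nat -> nat).
Hypothesis SE : forall i : 'I_n, S i = (xs i, vs i).
Hypothesis ordP : sorts_by_velocity n vs ord.
Hypothesis k_gt0 : (0 < k)%N.

Local Notation m := (k.-1 + k.-1)%N.

Definition decode (d : nat -> nat) : nat -> nat :=
  label xs vs d (fun j => A (d (k.-1 + j))) (fun j => B (d (k.-1 + j))) k.-1.

Definition label_cost (f : nat -> nat) : R := sd S (@clusters n k f).

Lemma eq_label_cost f g :
  (forall l, (l < n)%N -> f l = g l) -> label_cost f = label_cost g.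
Proof.
move=> fg; apply: eq_bigr => c _; congr diam; apply/setP => i.
by rewrite !inE fg.
Qed.

Lemma eq_decode d d' : (forall i, (i < m)%N -> d i = d' i) -> decode d =1 decode d'.
Proof.
move=> dd' l; apply: eq_label => i ik.
by rewrite !dd' // ?ltn_add2l // (leq_trans ik) ?leq_addr.
Qed.

Definition best_of (seen : (nat -> nat) -> Prop) (s : store R) : Prop :=
  ((0 < imem s 21 0)%N -> rmem s 7 0 = label_cost (imem s 1) /\
     forall l, (l < n)%N -> (imem s 1 l < k)%N) /\
  forall d, valid_digits bound m d -> seen d ->
     (0 < imem s 21 0)%N /\ rmem s 7 0 <= label_cost (decode d).

(** The new vectors are given by equality of decoded labels, because digits beyond the last position
    may differ. *)
Lemma keep_best_halts s seen d0 :
  imem s 0 0 = n -> best_of seen s ->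
  (forall l, (l < n)%N -> imem s 13 l = decode d0 l) ->
  rmem s 6 0 = label_cost (imem s 13) ->
  halts keep_best_cmd (100 * n.+1) s
    (best_of (fun d => seen d \/ decode d =1 decode d0)).
Proof.
move=> n0 [out best] lab0 cost0.
have cost_d0 : rmem s 6 0 = label_cost (decode d0).
  by rewrite cost0; exact: eq_label_cost.
apply: (@halts_weaken _ _ _ (11 + (4 + (3 + (n * (20 + 2 + 13) + 2 + 9)))).+1) => //;
  last 2 first.
- by lia.
- by move=> s'; exact.
apply: halts_if; case: ifP => [better|worse].
  apply: halts_seq_run => //; apply: halts_seq_run => //; set s1 := run _ _.
  pose J i (s' : store R) := forall l, (l < i)%N -> imem s' 1 l = imem s 13 l.
  apply: halts_weaken (halts_frame (@halts_for _ 15 n_exp _ J n 20 s1 _ _ _ _))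
    (leqnn _) _ => //.
  - by move=> s' [iu _]; rewrite /= iu.
  - move=> i s2 lt_in [iu _] i2 J2; apply: halts_run_le => // l /=.
    rewrite ltnS leq_eqVlt /update /= i2 iu // => /predU1P[->|li].
      by rewrite eqxx.
    by rewrite (ltn_eqF li) J2.
  - move=> s2 [J2 [iu ru]]; rewrite /best_of iu // ru //.
    have -> : imem s1 21 0 = 1 by [].
    have -> : rmem s1 7 0 = rmem s 6 0 by [].
    split=> [_|d vd seen_d].
      split=> [|l lt_ln]; first by rewrite cost0; apply: eq_label_cost => l /J2 ->.
      rewrite J2 // lab0 // -(prednK k_gt0) ltnS; exact: label_le.
    split=> //; case: seen_d => [/(best d vd)[flag le_d]|dd0].
      move: better; rewrite /= flag /= -ltNge => lt67.
      exact: le_trans (ltW lt67) le_d.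
    by rewrite cost_d0 le_eqVlt (@eq_label_cost _ (decode d)) ?eqxx // => l _; rewrite dd0.
apply: halts_run_le => //=; split; first exact: out.
move=> d vd [seen_d|dd0]; first exact: best.

move: worse; rewrite /= => /negbT; rewrite negbK => /andP[flag le76].
split=> //; rewrite (@eq_label_cost _ (decode d0)) ?dd0 -?cost_d0 //.
Qed.

Definition search_static (s : store R) : Prop :=
  leaf_ready n k xs vs ord s /\ [/\ imem s 6 = A, imem s 7 = B & imem s 11 = bound].

(** The odometer runs in order of value, so the vectors seen are those below the current one, and
    all of them once flag 20 is cleared. *)
Definition seen_at (s : store R) (d : nat -> nat) : Prop :=
  imem s 20 0 = 0 \/ (value bound m d < value bound m (imem s 12))%N.

Definition search_inv (s : store R) : Prop :=
  best_of (seen_at s) s /\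
  ((0 < imem s 20 0)%N -> valid_digits bound m (imem s 12)).

Definition search_left (s : store R) : nat :=
  if (0 < imem s 20 0)%N then (weight bound m - value bound m (imem s 12))%N else 0%N.

Lemma leaf_halts s : search_static s -> search_inv s -> (0 < imem s 20 0)%N ->
  halts leaf_cmd (4000 * k.+1 * n.+1) s
    (fun s' => search_inv s' /\ (search_left s' < search_left s)%N).
Proof.
move=> [ready [A0 B0 bd0]] [best vd] go; have {}vd := vd go.
have [ord_lt ord_surj ord_mono] := ordP.
set d0 := imem s 12 in vd.
apply: (@halts_weaken _ _ _
  (300 * k.+1 * n.+1 + (3000 * k.+1 * n.+1 + (100 * n.+1 + 200 * k.+1)))) => //;
  last 2 first.
- by nia.
- by move=> s'; exact.
apply: halts_seq; first exact: halts_frame (labels_halts ready (erefl d0) A0 B0).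
move=> s1 [lab1 [iu1 ru1]].
have ready1 : leaf_ready n k xs vs ord s1 by move: ready; rewrite /leaf_ready !iu1 ?ru1.
apply: halts_seq.
  exact: halts_frame (cost_halts SE ord_lt ord_surj ord_mono ready1).
move=> s2 [cost2 [iu2 ru2]].
have [[n2 k2 _] _] : leaf_ready n k xs vs ord s2.
  by move: ready1; rewrite /leaf_ready !iu2 ?ru2.
apply: halts_seq.
  apply: halts_frame; apply: (@keep_best_halts s2 (seen_at s) d0) => //.
  - move: best; rewrite /best_of (iu2 21) // (iu2 1) // ru2 // (iu1 21) // (iu1 1) // ru1 //.
  - by move=> l lt_ln; rewrite iu2 // lab1.
  - by rewrite cost2 iu2.
move=> s3 [best3 [iu3 ru3]].
have d3 : imem s3 12 = d0 by rewrite iu3 // iu2 // iu1.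
have k3 : imem s3 0 1 = k by rewrite iu3.
have bd3 : imem s3 11 = bound by rewrite iu3 // iu2 // iu1.
have go3 : imem s3 20 0 = imem s 20 0 by rewrite iu3 // iu2 // iu1.
apply: halts_weaken (halts_frame (next_halts k3 bd3 d3 vd)) (leqnn _) _.
move=> s4 [next [iu4 ru4]].
have best4 : best_of (fun d => seen_at s d \/ decode d =1 decode d0) s4.
  by move: best3; rewrite /best_of (iu4 21) // (iu4 1) // ru4.
have seen_all d : valid_digits bound m d -> (value bound m d <= value bound m d0)%N ->
    seen_at s d \/ decode d =1 decode d0.
  move=> vd'; rewrite leq_eqVlt => /predU1P[e|lt_d]; last by left; right.
  by right; apply: eq_decode; exact: value_inj e.
rewrite /search_inv /search_left go.
have lt_d0 := value_lt vd.
case: next => [[vd4 val4 go4]|[go4 full]].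
  rewrite go4 go3 go val4 -/d0; split; last by lia.
  split=> //; split; first exact: best4.1.
  move=> d vd' seen; apply: best4.2 => //; apply: seen_all => //.
  case: seen; first by rewrite go4 go3 => e; rewrite e in go.
  by rewrite val4 addn1 ltnS.
rewrite go4 /= -/d0; split; last by rewrite subn_gt0.
split=> //; split; first exact: best4.1.
move=> d vd' _; apply: best4.2 => //; apply: seen_all => //.
by have := value_lt vd'; rewrite full addn1 ltnS.
Qed.

Lemma search_halts s : search_static s -> imem s 21 0 = 0 ->
  imem s 12 = (fun=> 0) -> (forall i, (i < m)%N -> (0 < bound i)%N) ->
  halts search_cmd (weight bound m * (4000 * k.+1 * n.+1 + 5) + 8) s
    (best_of (fun=> True)).
Proof.
move=> static flag0 d0 bound_gt0.
apply: (@halts_weaken _ _ _ (3 + (weight bound m * (4000 * k.+1 * n.+1 + 5) + 5)))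
  => //; last 2 first.
- by lia.
- by move=> s'; exact.
apply: halts_seq_run => //; set s1 := run _ _.
have static1 : search_static s1 by [].
have go1 : imem s1 20 0 = 1 by [].
have {}flag1 : imem s1 21 0 = 0 by [].
have {}d1 : imem s1 12 = (fun=> 0) by [].
move: s1 static1 go1 flag1 d1 => {static flag0 d0} s1 static1 go1 flag1 d1.
apply: halts_weaken (@halts_while R (BILe (IConst 1) (IVar 20)) leaf_cmd
  search_inv search_left _ _ s1 _ _ _) (leqnn _) _.
- move=> s2 [iu ru] inv2 /= go2; apply: leaf_halts => //.
  move: static1; rewrite /search_static /leaf_ready !iu ?ru //.
- split.
    split=> [|d vd []]; rewrite ?flag1 // ?go1 //.
    by rewrite d1 value0.
  by move=> _ i /bound_gt0; rewrite d1.
- by rewrite /search_left go1 /= d1 value0 subn0.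
- move=> s2 [[best2 _] /=]; rewrite -leqNgt leqn0 => /eqP go2.
  by split; [exact: best2.1|move=> d vd _; apply: best2.2 => //; left].
Qed.

End Search.

(** The step from [j] needs [(j + 4) * 3/4 <= j + 3], because N is at most 3/4 n^2 for n at least 2;
    the offset 3 is the least one that works at [j = 0]. *)
Lemma factor_absorbed n N j : (1 < n)%N -> (2 * N = n * n.+1)%N ->
  ((j + 3) * N ^ j <= 3 * n ^ (2 * j))%N.
Proof.
move=> n_gt1 NE; elim: j => [|j IH]; first by rewrite muln0 !expn0.
rewrite mulnS expnD expnS.
have le3 : ((j.+1 + 3) * N <= (j + 3) * n ^ 2)%N by rewrite expnS expn1; nia.
have := leq_mul le3 (leqnn (N ^ j)).
have := leq_mul IH (leqnn (n ^ 2)).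
move: (N ^ j)%N (n ^ (2 * j))%N (n ^ 2)%N => u w z; nia.
Qed.

Lemma weight_bounds k N bound :
  (forall j, (j < k.-1)%N -> bound j = j.+1 /\ bound (k.-1 + j)%N = N) ->
  weight bound (k.-1 + k.-1) = (k.-1`! * N ^ k.-1)%N.
Proof.
move=> boundE; rewrite /weight big_split_ord /=; congr (_ * _)%N.
  rewrite fact_prod big_add1 big_mkord; apply: eq_bigr => i _.
  by have [] := boundE i (ltn_ord i).
rewrite -[X in (_ ^ X)%N]card_ord -prod_nat_const; apply: eq_bigr => i _.
by have [] := boundE i (ltn_ord i).
Qed.

(** In units of (k - 1)! n^(2k - 1), the search takes at most 3 * 2 * 4010 and the rest at most
    1000; the constant leaves ample room. *)
Lemma total_time n k N : (1 < k)%N -> (k <= n)%N -> (2 * N = n * n.+1)%N ->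
  (100 * n.+1 * n.+1 + (100 * n.+1 * n.+1 + (100 * k.+1 +
     (k.-1`! * N ^ k.-1 * (4000 * k.+1 * n.+1 + 5) + 8))) + 6 <=
   60 * 1000 * (k.-1`! * n ^ (2 * k - 1)))%N.
Proof.
case: k => [|[|j]] // _ jn NE.
have n_gt1 : (1 < n)%N by exact: leq_trans jn.
have := factor_absorbed j.+1 n_gt1 NE.
have -> : (n ^ (2 * j.+2 - 1) = n * n ^ (2 * j.+1))%N.
  by rewrite -expnS; congr (_ ^ _)%N; lia.
rewrite [j.+2.-1]/=.
have nP : (n ^ 2 <= n ^ (2 * j.+1))%N by rewrite leq_pexp2l //; lia.
have := fact_gt0 j.+1.
move: (N ^ j.+1)%N (n ^ (2 * j.+1))%N (j.+1)`!%N nP => u w f.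
rewrite expnS expn1 => nP f_gt0 uw.
have h1 : (f * u * (4000 * j.+3 * n.+1 + 5) <= f * (3 * w) * (2 * 4010 * n))%N.
  have ju : (j.+3 * u <= 3 * w)%N.
    by apply: (leq_trans _ uw); apply: leq_mul => //; lia.
  have e1 J : (0 < J)%N -> (4000 * J * n.+1 + 5 <= J * (2 * 4010 * n))%N.
    move=> J_gt0; have := leq_pmulr J (ltnW n_gt1).
    by rewrite mulnS mulnCA -(mulnA 4000); move: (J * n)%N => z; lia.
  have := leq_mul (leqnn (f * u)) (e1 j.+3 isT).
  have := leq_mul (leq_mul (leqnn f) ju) (leqnn (2 * 4010 * n)).
  rewrite !mulnA [(f * u * j.+3)%N]mulnAC => h h'.
  exact: leq_trans h' h.
have h2 : (n * n * n <= f * (n * w))%N.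
  rewrite -mulnA (leq_trans (leq_mul (leqnn n) nP)) // -[leqLHS]mul1n.
  exact: leq_mul.
have h3 : (200 * n.+1 * n.+1 + 100 * j.+3 + 14 <= 1000 * (n * n * n))%N.
  by clear -n_gt1 jn; nia.
have h5 : (f * (3 * w) * (2 * 4010 * n) = 3 * (2 * 4010) * (f * (n * w)))%N by ring.
move: h1; rewrite h5; move: (f * u * _)%N => y; move: (f * (n * w))%N h2 => X h2 h1.
lia.
Qed.

Lemma clustering_of_labels n k (f : nat -> nat) :
  (forall l, (l < n)%N -> (f l < k)%N) -> is_clustering (@clusters n k f).
Proof.
move=> f_lt; split.
  apply/setP => i; rewrite !inE; apply/bigcupP.
  by exists (Ordinal (f_lt i (ltn_ord i))); rewrite // inE.
move=> c c' cc'; apply/pred0P => i /=; rewrite !inE.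
by apply/negbTE/negP => /andP[/eqP -> /eqP/val_inj e]; rewrite e eqxx in cc'.
Qed.

Lemma clustering_cmd_correct (R : realType) n k (S : 'I_n -> trajectory R) :
  (1 <= k <= n)%N ->
  exists2 t : nat, finds_optimum clustering_cmd S k t
    & (t <= 60 * 1000 * ((k.-1)`! * n ^ (2 * k - 1)))%N.
Proof.
move=> /andP[k_gt0 kn]; have n_gt0 : (0 < n)%N by exact: leq_trans kn.
pose s := input_store S k; pose xs := rmem s 0; pose vs := rmem s 1.
have SE (i : 'I_n) : S i = (xs i, vs i).
  by rewrite /xs /vs /= valK; case: (S i).
have optimal f : (forall l, (l < n)%N -> (f l < k)%N) ->
    (forall C' : 'I_k -> {set 'I_n}, is_clustering C' ->
      sd S (@clusters n k f) <= sd S C') ->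
    optimal_clustering S (@clusters n k f).
  by move=> f_lt best; exact: (conj (clustering_of_labels f_lt) best).
suff [s' [t [ex le_t [f_lt best]]]] :
    halts clustering_cmd (60 * 1000 * ((k.-1)`! * n ^ (2 * k - 1))) s (fun s' =>
      (forall l, (l < n)%N -> (imem s' 1 l < k)%N) /\
      forall C' : 'I_k -> {set 'I_n}, is_clustering C' ->
        sd S (@clusters n k (imem s' 1)) <= sd S C').
  exists t => //; exists s' => //; exact: optimal.
(* For k = 1 the initial store already holds the answer: array 1 is zero, and the only cluster
   contains everything. *)
have [k1|k_gt1] := leqP k 1.
  have kE : k = 1 by lia.
  apply: (@halts_weaken _ _ _ (4 + 1).+1 _ (fun s' => s' = s)).
  - by apply: halts_if; rewrite /= k1; exact: halts_run.
  - have : (0 < (k.-1)`! * n ^ (2 * k - 1))%N by rewrite muln_gt0 fact_gt0 expn_gt0 n_gt0.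
    by lia.
  - move=> _ ->; split=> [l _|C' [cov _]]; first by rewrite /= kE.
    rewrite le_eqVlt; apply/orP; left; apply/eqP; apply: eq_bigr => c _; congr diam.
    have c0 (c' : 'I_k) : c' = c by apply: val_inj; move: (ltn_ord c) (ltn_ord c') => /=; lia.
    apply/setP => i; rewrite inE /=.
    have : i \in [set: 'I_n]%SET by rewrite inE.
    rewrite -cov => /bigcupP[c' _]; rewrite (c0 c') => ->.
    by have := ltn_ord c; case: (nat_of_ord c) => //; lia.
have s0n : imem s 0 0 = n by [].
have s0k : imem s 0 1 = k by [].
pose N := (n * n.+1)./2.
have NE : (2 * N = n * n.+1)%N.
  by rewrite /N mul2n -[RHS]odd_double_half oddM /= andbN.
apply: (@halts_weaken _ _ _ (4 + (100 * n.+1 * n.+1 + (100 * n.+1 * n.+1 + (100 * k.+1 +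
     (k.-1`! * N ^ k.-1 * (4000 * k.+1 * n.+1 + 5) + 8))))).+1) => //; last 2 first.
- by apply: leq_trans (total_time k_gt1 kn NE); lia.
- by move=> s'; exact.
apply: halts_if; rewrite /= leqNgt k_gt1 /=.
apply: halts_seq; first exact: halts_frame (sort_halts s0n).
move=> s1 [sorted [iu1 ru1]].
apply: halts_seq.
  by apply: halts_frame; apply: pairs_halts; rewrite iu1.
move=> s2 [[NE2 pairs] [iu2 ru2]].
have N2 : imem s2 10 0 = N by lia.
apply: halts_seq.
  by apply: halts_frame; apply: (@bounds_halts _ k); rewrite iu2 // iu1.
move=> s3 [bounds [iu3 ru3]]; rewrite N2 in bounds.
set ord := imem s1 2 in sorted pairs.
set A := imem s2 6 in pairs; set B := imem s2 7 in pairs.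
set bound := imem s3 11 in bounds.
have static : search_static n k xs vs ord A B bound s3.
  split; last by split; rewrite // iu3.
  by split; [split|split]; rewrite ?iu3 ?ru3 // ?iu2 ?ru2 // ?iu1 ?ru1.
have N_gt0 : (0 < N)%N by nia.
have bound_gt0 i : (i < k.-1 + k.-1)%N -> (0 < bound i)%N.
  move=> im; have [ik|ki] := ltnP i k.-1; first by have [-> _] := bounds i ik.
  by have [|_] := bounds (i - k.-1)%N; [lia | rewrite subnKC // => ->].
rewrite -(weight_bounds bounds).
apply: halts_weaken (search_halts SE sorted k_gt0 static _ _ bound_gt0) (leqnn _) _.
- by rewrite iu3 // iu2 // iu1.
- by rewrite iu3 // iu2 // iu1.
move=> s4 [out best].
have covers (C' : 'I_k -> {set 'I_n}) : is_clustering C' -> exists d, valid_digits bound (k.-1 + k.-1) d /\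
    label_cost k S (decode k xs vs A B d) <= sd S C'.
  move=> clC'; have [p [a [b [cuts le_C']]]] := labels_optimal SE n_gt0 k_gt0 clC'.
  have /choice[q qP] : forall j, exists q, (j < k.-1)%N ->
      [/\ (q < N)%N, A q = a j & B q = b j].
    move=> j; case: (ltnP j k.-1) => [jk|_]; last by exists 0.
    have [_ an bn ab] := cuts j jk.
    have [ord_lt ord_surj ord_mono] := sorted.
    have [la lt_la laE] := ord_surj _ an; have [lb lt_lb lbE] := ord_surj _ bn.
    case: ab => [baE|v_lt].
      have [|q lt_q [Aq Bq]] := pairs la la (leqnn _); first by [].
      by exists q => _; rewrite Aq Bq baE laE -N2.
    have [|q lt_q [Aq Bq]] := pairs la lb _ lt_la; last first.
      by exists q => _; rewrite Aq Bq laE lbE -N2.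
    rewrite leqNgt; apply/negP => lt_ab.
    have := ord_mono la lb (ltnW lt_ab) lt_lb.
    by rewrite laE lbE leNgt v_lt.
  (* The lower half of the digits are the parts to be cut, the upper half the table indices of the
     pairs. *)
  exists (fun i => if (i < k.-1)%N then p i else q (i - k.-1)%N); split.
    move=> i im; case: (ltnP i k.-1) => [ik|ki].
      by have [-> _] := bounds i ik; have [] := cuts i ik.
    have ik : (i - k.-1 < k.-1)%N by lia.
    have [_] := bounds _ ik; rewrite subnKC // => ->.
    by have [] := qP _ ik.
  rewrite (@eq_label_cost _ _ _ _ _ (label xs vs p a b k.-1)) // => l _.
  apply: eq_label => i ik; rewrite ik ltnNge leq_addr /= addKn.
  by have [_ -> ->] := qP i ik.
(* Any clustering will do here: one visited vector suffices for flag 21 to be set, so that array 1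
   holds a clustering. *)
have [d [vd _]] : exists d, valid_digits bound (k.-1 + k.-1) d /\
    label_cost k S (decode k xs vs A B d) <= sd S (@clusters n k (fun=> 0)).
  by apply: covers; apply: clustering_of_labels.
have [flag _] := best d vd I; have [costE f_lt] := out flag.
split=> // C' /covers[d' [vd' le_C']].
have [_ le_d'] := best d' vd' I.
by apply: le_trans le_C'; move: le_d'; rewrite costE.
Qed.

Theorem mainTheorem2 (R : realType) :
  (exists (P : cmd) (c : R),
     forall (n k : nat) (S : 'I_n -> trajectory R),
       (1 <= k <= n)%N -> injective S ->
       exists2 t : nat,
         finds_optimum P S k t
         & (1 < n)%N ->
           t%:R <= c * ((k.-1)`!%:R * n%:R ^+ (2 * k - 1) * ln n%:R))
  /\
  (forall k : nat, (1 <= k)%N ->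
     exists (P : cmd) (p : {poly R}),
       forall (n : nat) (S : 'I_n -> trajectory R),
         (k <= n)%N -> injective S ->
         exists2 t : nat, finds_optimum P S k t & t%:R <= p.[n%:R]).
Proof.
split.
  have ln2_gt0 : 0 < ln (2 : R) by apply: ln_gt0; lra.
  (* The running time is bounded without a logarithm; dividing by [ln 2] lets the factor [ln n], at
     least [ln 2], be inserted. *)
  exists clustering_cmd, ((60 * 1000) / ln 2) => n k S kn _.
  have [t opt le_t] := clustering_cmd_correct S kn.
  exists t => // n_gt1.
  have ln_le : ln 2 <= ln (n%:R : R).
    by rewrite ler_ln ?posrE ?ltr0n ?(ltnW n_gt1) // ler_nat.
  set X := (k.-1)`!%:R * n%:R ^+ (2 * k - 1).
  have le_X : t%:R <= 60 * 1000 * X.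
    by rewrite /X -natrX -!natrM ler_nat.
  have X_ge0 : 0 <= X by rewrite mulr_ge0 // exprn_ge0.
  apply: le_trans le_X _.
  have -> : (60 * 1000) / ln 2 * (X * ln n%:R) = 60 * 1000 * X * (ln n%:R / ln 2) by ring.
  apply: ler_peMr; last by rewrite ler_pdivlMr // mul1r.
  exact: mulr_ge0 (mulr_ge0 (ler0n _ 60) (ler0n _ 1000)) X_ge0.
move=> k k_gt0; exists clustering_cmd, ((60 * 1000 * (k.-1)`!)%:R *: 'X^(2 * k - 1)).
move=> n S kn _.
have [|t opt le_t] := @clustering_cmd_correct R n k S; first by rewrite k_gt0.
exists t => //; rewrite hornerZ hornerXn -natrX -natrM ler_nat.
by rewrite -mulnA.
Qed.
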